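(* (1) (Duality between $\Gamma^{\mathbb L}_+(\mathbf x)$ and $\Gamma_{\mathbb L}(\mathbf y)$.) Let all indices range over strict partitions. If $Q^{\mathbb L}_\lambda(\mathbf x)Q^{\mathbb L}_\mu(\mathbf x)=\sum_{\nu\in\mathcal{SP}}c^\nu_{\lambda,\mu}\,Q^{\mathbb L}_\nu(\mathbf x)$ with $c^\nu_{\lambda,\mu}\in\mathbb L$, then $$\phi(\widehat p^{\mathbb L}_\nu(\mathbf y))=\sum_{\lambda,\mu\in\mathcal{SP}}c^\nu_{\lambda,\mu}\,\widehat p^{\mathbb L}_\lambda(\mathbf y)\otimes\widehat p^{\mathbb L}_\mu(\mathbf y).$$ If $\phi(Q^{\mathbb L}_\nu(\mathbf x))=\sum_{\lambda,\mu\in\mathcal{SP}}\widehat c^\nu_{\lambda,\mu}\,Q^{\mathbb L}_\lambda(\mathbf x)\otimes Q^{\mathbb L}_\mu(\mathbf x)$ with $\widehat c^\nu_{\lambda,\mu}\in\mathbb L$, then $$\widehat p^{\mathbb L}_\lambda(\mathbf y)\,\widehat p^{\mathbb L}_\mu(\mathbf y)=\sum_{\nu\in\mathcal{SP}}\widehat c^\nu_{\lambda,\mu}\,\widehat p^{\mathbb L}_\nu(\mathbf y).$$ (2) (Duality between $\Gamma^{\mathbb L}(\mathbf x)$ and $\Gamma^+_{\mathbb L}(\mathbf y)$.) If $P^{\mathbb L}_\lambda(\mathbf x)P^{\mathbb L}_\mu(\mathbf x)=\sum_{\nu\in\mathcal{SP}}d^\nu_{\lambda,\mu}\,P^{\mathbb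 L}_\nu(\mathbf x)$ with $d^\nu_{\lambda,\mu}\in\mathbb L$, then $$\phi(\widehat q^{\mathbb L}_\nu(\mathbf y))=\sum_{\lambda,\mu\in\mathcal{SP}}d^\nu_{\lambda,\mu}\,\widehat q^{\mathbb L}_\lambda(\mathbf y)\otimes\widehat q^{\mathbb L}_\mu(\mathbf y).$$ If $\phi(P^{\mathbb L}_\nu(\mathbf x))=\sum_{\lambda,\mu\in\mathcal{SP}}\widehat d^\nu_{\lambda,\mu}\,P^{\mathbb L}_\lambda(\mathbf x)\otimes P^{\mathbb L}_\mu(\mathbf x)$ with $\widehat d^\nu_{\lambda,\mu}\in\mathbb L$, then $$\widehat q^{\mathbb L}_\lambda(\mathbf y)\,\widehat q^{\mathbb L}_\mu(\mathbf y)=\sum_{\nu\in\mathcal{SP}}\widehat d^\nu_{\lambda,\mu}\,\widehat q^{\mathbb L}_\nu(\mathbf y).$$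
   Context: $\mathbb L$ is the Lazard ring with universal formal group law $F_{\mathbb L}(u,v)=u+v+\sum_{i,j\ge1}a_{i,j}u^iv^j$; $a+_Fb=F_{\mathbb L}(a,b)$ and $\overline a\in\mathbb L[[a]]$ is the formal inverse ($a+_F\overline a=0$). $\mathcal{SP}$ is the set of all strict partitions. For a strict partition $\lambda=(\lambda_1>\cdots>\lambda_r>0)$ and $n\ge r$, $$P^{\mathbb L}_\lambda(x_1,\ldots,x_n)=\frac1{(n-r)!}\sum_{w\in S_n}w\Big[\prod_{i=1}^rx_i^{\lambda_i}\prod_{i=1}^r\prod_{j=i+1}^n\frac{x_i+_Fx_j}{x_i+_F\overline x_j}\Big],$$ $$Q^{\mathbb L}_\lambda(x_1,\ldots,x_n)=\frac1{(n-r)!}\sum_{w\in S_n}w\Big[\prod_{i=1}^r(x_i+_Fx_i)x_i^{\lambda_i-1}\prod_{i=1}^r\prod_{j=i+1}^n\frac{x_i+_Fx_j}{x_i+_F\overline x_j}\Big]$$ ($S_n$ permuting $x_1,\ldots,x_n$; both $0$ for $n<r$), and $P^{\mathbb L}_\lambda(\mathbf x),Q^{\mathbb L}_\lambda(\mathbf x)$ are their inverse limits along $x_{n+1}=0$. A power series $f(x_1,\ldots,x_n)$ over $\mathbb L$ is $\mathbb L$-supersymmetric if it is symmetric and $f(t,\overline t,x_3,\ldots,x_n)=f(0,0,x_3,\ldots,x_n)$; $\Gamma^{\mathbb L}(\mathbf x_n)$ is the ring of these, $\Gamma^{\mathbb L}_+(\mathbf x_n)$ the subring of those with $f(t,x_2,\ldots,x_n)-f(0,x_2,\ldots,x_n)$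 divisible by $t+_Ft$, and $\Gamma^{\mathbb L}(\mathbf x),\Gamma^{\mathbb L}_+(\mathbf x)$ are the inverse limits along $x_{n+1}=0$. The $P^{\mathbb L}_\lambda(\mathbf x)$ (resp. $Q^{\mathbb L}_\lambda(\mathbf x)$) form a formal $\mathbb L$-basis of $\Gamma^{\mathbb L}(\mathbf x)$ (resp. $\Gamma^{\mathbb L}_+(\mathbf x)$), i.e. elements have unique expansions as possibly infinite $\mathbb L$-linear combinations of them. Let $\Lambda_{\mathbb L}(\mathbf y)=\mathbb L\otimes_{\mathbb Z}\Lambda(\mathbf y)$, symmetric functions in $\mathbf y=(y_1,y_2,\ldots)$ over $\mathbb L$. Define $\widehat q^{\mathbb L}_k(\mathbf y),\widehat p^{\mathbb L}_k(\mathbf y)\in\Lambda_{\mathbb L}(\mathbf y)$ by $\prod_{j\ge1}\frac{1-\overline ty_j}{1-ty_j}=\sum_{k\ge0}\widehat q^{\mathbb L}_k(\mathbf y)t^k=1+(t+_Ft)\sum_{k\ge1}\widehat p^{\mathbb L}_k(\mathbf y)t^{k-1}$; $\Gamma_{\mathbb L}(\mathbf y)$ (resp. $\Gamma^+_{\mathbb L}(\mathbf y)$) is the $\mathbb L$-subalgebra generated by the $\widehat p^{\mathbb L}_k(\mathbf y)$ (resp. $\widehat q^{\mathbb L}_k(\mathbf y)$), $k\ge1$. The functions $\widehat p^{\mathbb L}_\lambda(\mathbf y)\in\Gamma_{\mathbb L}(\mathbf y)$, $\widehat q^{\mathbb L}_\lambda(\mathbf y)\in\Gamma^+_{\mathbb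 L}(\mathbf y)$ are defined by $$\prod_{i,j\ge1}\frac{1-\overline x_iy_j}{1-x_iy_j}=\sum_{\lambda\in\mathcal{SP}}Q^{\mathbb L}_\lambda(\mathbf x)\,\widehat p^{\mathbb L}_\lambda(\mathbf y)=\sum_{\lambda\in\mathcal{SP}}P^{\mathbb L}_\lambda(\mathbf x)\,\widehat q^{\mathbb L}_\lambda(\mathbf y).$$ The coproduct $\phi$ in each ring is the usual coproduct of symmetric functions: $\phi(f)$ is $f(\mathbf x,\mathbf x')$ (resp. $f(\mathbf y,\mathbf y')$), the evaluation at the union of two countable sets of variables, written in terms of the two sets separately ($g\otimes h$ standing for $g(\mathbf x)h(\mathbf x')$, resp. $g(\mathbf y)h(\mathbf y')$). *)

(* Defs.v *)
From HB Require Import structures.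
From mathcomp Require Import all_boot all_order all_fingroup all_algebra.
From mathcomp Require Import finmap multiset zify.
From mathcomp Require Import boolp classical_sets cardinality fsbigop.

Set Implicit Arguments.
Unset Strict Implicit.
Unset Printing Implicit Defensive.

Import GRing.Theory.

Local Open Scope fset_scope.
Local Open Scope classical_set_scope.
Local Open Scope ring_scope.
Local Open Scope mset_scope.

(* A monomial in the variables indexed by [I] is a finite multiset on [I], so
   [mfps nat R] is the inverse limit of the rings R[[x_1,...,x_n]] along
   x_{n+1} = 0: degrees may be unbounded, but each monomial involves finitely
   many variables. *)
Record mfps (I : choiceType) (R : Type) := MFPS { mcoef : {mset I} -> R }.

Notation "f @_ m" := (mcoef f m) (at level 3, m at level 2, left associativity, format "f @_ m").

HB.instance Definition _ I R := gen_eqMixin (mfps I R).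
HB.instance Definition _ I R := gen_choiceMixin (mfps I R).

Section Ring.
Variables (I : choiceType) (R : comNzRingType).
Implicit Types (f g h : mfps I R) (m a b c : {mset I}).

Lemma mfpsP f g : (forall m, f@_m = g@_m) -> f = g.
Proof. by case: f g => [f] [g] /= fg; congr MFPS; apply/funext. Qed.

Definition mconst (x : R) := MFPS (fun m : {mset I} => if m == mset0 then x else 0).
Definition madd f g := MFPS (fun m => f@_m + g@_m).
Definition mopp f := MFPS (fun m => - f@_m).
Definition mscale (x : R) f := MFPS (fun m => x * f@_m).
Definition mmul f g :=
  MFPS (fun m => \sum_(a \in [set a : {mset I} | msubset a m]) f@_a * g@_(m `\` a)%mset).

Lemma finite_msubset m : finite_set [set a : {mset I} | msubset a m].
Proof.
pose F (k : {ffun finsupp m -> 'I_(\sum_(i <- finsupp m) m i).+1}) : {mset I} :=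
  [fsfun i : finsupp m => val (k i) | 0%N].
apply: (@sub_finite_set _ _ (F @` setT)); last exact: finite_image.
move=> a /= /msubsetP le_am.
have bnd (i : finsupp m) : (a (val i) < (\sum_(i <- finsupp m) m i).+1)%N.
  rewrite ltnS (leq_trans (le_am _))//.
  by rewrite (big_rem (val i)) ?leq_addr//=; apply: valP.
exists [ffun i => Ordinal (bnd i)] => //.
apply/msetP => i; rewrite /F fsfun_ffun; case: insubP => [u um <-|im] /=.
  by rewrite ffunE.
apply/esym/eqP; rewrite -leqn0 (leq_trans (le_am i))//.
by rewrite leqn0 mset_eq0 -msuppE.
Qed.

Let D m := fset_set [set a : {mset I} | msubset a m].

Let inD m a : (a \in D m) = msubset a m.
Proof.
by rewrite in_fset_set; [apply/idP/idP; rewrite inE | exact: finite_msubset].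
Qed.

Let mulE f g m (A : {fset {mset I}}) : {subset D m <= A} ->
  (mmul f g)@_m = \sum_(a <- A) \sum_(b <- A | a `+` b == m) f@_a * g@_b.
Proof.
move=> DA; rewrite /= fsbig_finite; last exact: finite_msubset.
rewrite [RHS](bigID [pred a | a \in D m]) /= [X in _ = _ + X]big1 ?addr0; last first.
  move=> a; rewrite inD => aNm; rewrite big1 // => b /eqP abm.
  case/negP: aNm; rewrite -abm; apply/msubsetP => i.
  by rewrite !msetE2 leq_addr.
rewrite -[in RHS]big_filter -/(D m).
have -> : \sum_(a <- D m) f@_a * g@_(m `\` a)%mset =
   \sum_(a <- [seq a <- A | a \in D m]) f@_a * g@_(m `\` a)%mset.
  apply: perm_big; apply: uniq_perm; rewrite ?fset_uniq ?filter_uniq ?fset_uniq//.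
  by move=> a; rewrite mem_filter; case: (boolP (a \in D m)) => // /DA ->.
rewrite !big_filter; apply: eq_bigr => a; rewrite inD => am.
rewrite -big_filter (bigD1_seq (m `\` a)) ?filter_uniq ?fset_uniq//=; last first.
  rewrite mem_filter msetBDKC// eqxx/= DA// inD; apply/msubsetP => i.
  by rewrite !msetE2 leq_subr.
rewrite big_filter_cond big1 ?addr0// => b /andP[/eqP <-] /negP[].
apply/eqP/msetP => i; rewrite !msetE2; exact/esym/addKn.
Qed.

Fact maddA : associative madd.
Proof. by move=> f g h; apply/mfpsP => m /=; rewrite addrA. Qed.
Fact maddC : commutative madd.
Proof. by move=> f g; apply/mfpsP => m /=; rewrite addrC. Qed.
Fact madd0 : left_id (mconst 0) madd.
Proof. by move=> f; apply/mfpsP => m /=; rewrite if_same add0r. Qed.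
Fact maddN : left_inverse (mconst 0) mopp madd.
Proof. by move=> f; apply/mfpsP => m /=; rewrite if_same addNr. Qed.

HB.instance Definition _ := GRing.isZmodule.Build (mfps I R) maddA maddC madd0 maddN.

Fact mmulC : commutative mmul.
Proof.
move=> f g; apply/mfpsP => m; rewrite !(@mulE _ _ _ (D m))//.
under eq_bigr do rewrite big_mkcond /=.
rewrite exchange_big; apply: eq_bigr => a _ /=; rewrite [RHS]big_mkcond.
by apply: eq_bigr => b _; rewrite msetDC mulrC.
Qed.

Let subD m a : msubset a m -> {subset D a <= D m}.
Proof. by move=> am b; rewrite !inD => ba; apply: msubset_trans am. Qed.

Let addD_l m a b : a `+` b = m -> msubset a m.
Proof. by move=> <-; apply/msubsetP => i; rewrite !msetE2 leq_addr. Qed.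
Let addD_r m a b : a `+` b = m -> msubset b m.
Proof. by move=> <-; apply/msubsetP => i; rewrite !msetE2 leq_addl. Qed.

Let mulA_ f g h m : (mmul f (mmul g h))@_m =
  \sum_(a <- D m) \sum_(b <- D m) \sum_(c <- D m)
    if a `+` (b `+` c) == m then f@_a * (g@_b * h@_c) else 0.
Proof.
rewrite (@mulE _ _ _ (D m))//; apply: eq_bigr => a _.
have -> : \sum_(d <- D m | a `+` d == m) f@_a * (mmul g h)@_d =
   \sum_(d <- D m | a `+` d == m) f@_a *
     \sum_(b <- D m) \sum_(c <- D m | b `+` c == d) g@_b * h@_c.
  apply: eq_bigr => d /eqP adm; rewrite (@mulE _ _ _ (D m))//.
  by apply: subD; apply: addD_r adm.
under eq_bigr do rewrite mulr_sumr.
rewrite exchange_big /=; apply: eq_bigr => b _.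
under eq_bigr do rewrite mulr_sumr big_mkcond /=.
rewrite exchange_big /=; apply: eq_bigr => c _.
have [abcm|abcm] := eqVneq (a `+` (b `+` c)) m; last first.
  rewrite big1// => d /eqP adm; case: eqP => // bcd.
  by rewrite -bcd in adm; rewrite adm eqxx in abcm.
rewrite -big_filter (bigD1_seq (b `+` c)) ?filter_uniq ?fset_uniq ?eqxx//=.
  rewrite big1 ?addr0// => d; rewrite eq_sym => /negPf -> //.
by rewrite mem_filter abcm eqxx inD; apply: addD_r abcm.
Qed.

Fact mmulA : associative mmul.
Proof.
move=> f g h; apply/mfpsP => m; rewrite mulA_ [mmul _ h]mmulC mulA_.
rewrite [RHS]exchange_big; apply: eq_bigr => a _ /=.
rewrite [RHS]exchange_big; apply: eq_bigr => b _ /=.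
apply: eq_bigr => c _; rewrite [c `+` _]msetDC -msetDA.
by case: ifP => // _; rewrite [RHS]mulrC mulrA.
Qed.

Fact mmul1 : left_id (mconst 1) mmul.
Proof.
move=> f; apply/mfpsP => m /=; rewrite fsbig_finite; last exact: finite_msubset.
rewrite (bigD1_seq mset0) ?fset_uniq//=; last by rewrite -/(D m) inD msub0set.
rewrite eqxx mul1r msetB0 big1 ?addr0// => a /negPf ->.
by rewrite mul0r.
Qed.

Fact mmulDl : left_distributive mmul madd.
Proof.
move=> f g h; apply/mfpsP => m.
rewrite [LHS](@mulE _ _ _ (D m))// /madd.
have -> : (madd (mmul f h) (mmul g h))@_m = (mmul f h)@_m + (mmul g h)@_m by [].
rewrite !(@mulE _ _ _ (D m))// -big_split.
by apply: eq_bigr => a _ /=; rewrite -big_split; apply: eq_bigr => b _; rewrite mulrDl.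
Qed.

Fact mone_neq0 : mconst 1 != mconst 0.
Proof.
apply/eqP => /(congr1 (fun f => f@_mset0)) /=; rewrite eqxx.
by apply/eqP; rewrite oner_neq0.
Qed.

HB.instance Definition _ :=
  GRing.Zmodule_isComNzRing.Build (mfps I R) mmulA mmulC mmul1 mmulDl mone_neq0.

Fact mscaleA (x y : R) f : mscale x (mscale y f) = mscale (x * y) f.
Proof. by apply/mfpsP => m /=; rewrite mulrA. Qed.
Fact mscale1 : left_id 1 mscale.
Proof. by move=> f; apply/mfpsP => m /=; rewrite mul1r. Qed.
Fact mscaleDr : right_distributive mscale +%R.
Proof. by move=> x f g; apply/mfpsP => m /=; rewrite mulrDr. Qed.
Fact mscaleDl f : {morph mscale^~ f : x y / x + y}.
Proof. by move=> x y; apply/mfpsP => m /=; rewrite mulrDl. Qed.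

HB.instance Definition _ := GRing.Zmodule_isLmodule.Build R (mfps I R)
  mscaleA mscale1 mscaleDr mscaleDl.

Fact mscaleAl (x : R) f g : x *: (f * g) = x *: f * g.
Proof.
apply/mfpsP => m; rewrite [RHS](@mulE _ _ _ (D m))//.
have -> : (x *: (f * g))@_m = x * (mmul f g)@_m by [].
rewrite (@mulE _ _ _ (D m))// mulr_sumr; apply: eq_bigr => a _.
by rewrite mulr_sumr; apply: eq_bigr => b _; rewrite /= mulrA.
Qed.

HB.instance Definition _ := GRing.Lmodule_isLalgebra.Build R (mfps I R) mscaleAl.

Lemma mcoefM f g m :
  (f * g)@_m = \sum_(a \in [set a : {mset I} | msubset a m]) f@_a * g@_(m `\` a)%mset.
Proof. by []. Qed.

Definition munit : pred (mfps I R) := [pred f | `[< exists g, g * f = 1 >]].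
Definition minv f := if munit f then xget 0 [set g | g * f = 1] else f.

Fact mmulVr : {in munit, left_inverse 1 minv *%R}.
Proof.
move=> f fU; rewrite /minv ifT//; have /asboolP[g gf] := fU.
by have := @xgetPex _ 0 [set g | g * f = 1]; apply; exists g.
Qed.
Fact munitP f g : g * f = 1 -> munit f.
Proof. by move=> gf; apply/asboolP; exists g. Qed.
Fact minv_out : {in [predC munit], minv =1 id}.
Proof. by move=> f; rewrite inE /minv => /negPf fNU; rewrite ifF. Qed.

HB.instance Definition _ :=
  GRing.ComNzRing_hasMulInverse.Build (mfps I R) mmulVr munitP minv_out.

End Ring.

Section Domain.
Variables (I : choiceType) (R : idomainType).
Implicit Types (f g : mfps I R) (a b c m : {mset I}) (s : seq I).

Fixpoint lexle s a b : Prop :=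
  if s is i :: s' then (a i < b i)%N \/ (a i = b i /\ lexle s' a b) else True.

Lemma lexle_min s (S : set {mset I}) : S !=set0 ->
  exists2 a, S a & forall b, S b -> lexle s a b.
Proof.
elim: s S => [|i s IHs] S [a0 Sa0]; first by exists a0.
have exk : exists k, `[< exists2 a : {mset I}, S a & a i = k >].
  by exists (a0 i); apply/asboolP; exists a0.
case: (ex_minnP exk) => k /asboolP[a1 Sa1 a1k] kmin.
have [|a [Sa ak] amin] := IHs [set a : {mset I} | S a /\ a i = k].
  by exists a1.
exists a => // b Sb /=; have : (k <= b i)%N by apply: kmin; apply/asboolP; exists b.
rewrite leq_eqVlt ak => /orP[/eqP kb|]; last by left.
by right; split=> //; apply: amin.
Qed.

Lemma lexle_addI s a b c d : lexle s a c -> lexle s b d ->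
  (forall i, c i + d i = a i + b i)%N -> {in s, forall i, c i = a i}.
Proof.
move=> + + cd; elim: s => [|i s IHs] //= ac bd j.
have := cd i; case: ac bd => [ac|[ac ac']] [bd|[bd bd']] cdi; try lia.
by rewrite inE => /predU1P[->//|]; apply: IHs.
Qed.

Fact mfps_integral f g : f * g = 0 -> (f == 0) || (g == 0).
Proof.
move=> fg0; have [//|f0] := eqVneq f 0; have [//|g0] := eqVneq g 0; exfalso.
have nz (h : mfps I R) : h != 0 -> exists a, h@_a != 0.
  move=> h0; apply: contrapT => /forallNP hn; case/eqP: h0; apply/mfpsP => m.
  by have [->|/hn//] := eqVneq h@_m 0; rewrite /= if_same.
have [a0 fa0] := nz f f0; have [b0 gb0] := nz g g0.
pose s : seq I := enum_mset (a0 `+` b0).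
pose S (h : mfps I R) := [set a : {mset I} | h@_a != 0 /\ {subset a <= s}].
have [|a [fa sa] amin] := @lexle_min s (S f).
  by exists a0; split=> // i ia; rewrite /s/= in_msetD ia.
have [|b [gb sb] bmin] := @lexle_min s (S g).
  by exists b0; split=> // i ib; rewrite /s/= in_msetD ib orbT.
have : (f * g)@_(a `+` b) = 0 by rewrite fg0 /= if_same.
rewrite mcoefM fsbig_finite; last exact: finite_msubset.
rewrite (bigD1_seq a) ?fset_uniq//=; last first.
  rewrite in_fset_set; last exact: finite_msubset.
  by rewrite inE; apply/msubsetP => i; rewrite msetE2 leq_addr.
rewrite big1_seq ?addr0.
  have -> : ((a `+` b) `\` a)%mset = b by apply/msetP => i; rewrite !msetE2 addKn.
  by apply/eqP; rewrite mulf_neq0.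
move=> c /andP[ca]; rewrite in_fset_set; last exact: finite_msubset.
rewrite inE /= => cab; apply/eqP; apply: contraNT ca.
rewrite mulf_eq0 negb_or => /andP[fc gd]; apply/eqP/msetP => i.
set d := (_ `\` c)%mset in gd.
have cd j : (c j + d j = a j + b j)%N.
  by rewrite /d !msetE2 subnKC// -msetE2; move/msubsetP: cab.
have sab j : (0 < a j + b j)%N -> j \in s.
  by rewrite addn_gt0 -!in_mset => /orP[/sa|/sb].
have [js|js] := boolP (i \in s); last first.
  have : ~ (0 < a i + b i)%N by move=> /sab; apply/negP.
  by have := cd i; lia.
apply: (lexle_addI _ _ cd js).
  by apply: amin; split=> // j; rewrite in_mset => ?; apply: sab; rewrite -cd; lia.
by apply: bmin; split=> // j; rewrite in_mset => ?; apply: sab; rewrite -cd; lia.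
Qed.

HB.instance Definition _ :=
  GRing.ComUnitRing_isIntegral.Build (mfps I R) mfps_integral.

End Domain.

Section Operations.
Variables (R : comNzRingType).

Definition mvar (I : choiceType) (i : I) : mfps I R :=
  MFPS (fun m => (m == [mset i])%:R).

Definition mrename (I J : choiceType) (iota : I -> J) (m : {mset I}) : {mset J} :=
  seq_mset [seq iota i | i <- m].

(* For an injective [iota : I -> J]: set the variables outside the image of
   [iota] to 0 and rename [iota i] to [i]. *)
Definition mrestr (I J : choiceType) (iota : I -> J) (f : mfps J R) : mfps I R :=
  MFPS (fun m => f@_(mrename iota m)).

Definition minl (I J : choiceType) (m : {mset (I + J)%type}) : {mset I} :=
  seq_mset (pmap (fun s => if s is inl i then Some i else None) m).

Definition minr (I J : choiceType) (m : {mset (I + J)%type}) : {mset J} :=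
  seq_mset (pmap (fun s => if s is inr j then Some j else None) m).

(* The product f(x) g(x') in the disjoint union of the two sets of variables. *)
Definition mtens (I J : choiceType) (f : mfps I R) (g : mfps J R) :
    mfps (I + J)%type R :=
  MFPS (fun m => f@_(minl m) * g@_(minr m)).

Definition interleave (s : nat + nat) : nat :=
  match s with inl i => i.*2 | inr i => i.*2.+1 end.

(* The evaluation f(x, x') of a symmetric f at the union of two countable sets
   of variables; by symmetry the bijection [interleave] used to index this
   union is irrelevant. *)
Definition mcoprod (f : mfps nat R) : mfps (nat + nat)%type R :=
  mrestr interleave f.

Definition msymmetric (f : mfps nat R) :=
  forall s : nat -> nat, bijective s -> mrestr s f = f.

(* The ring of symmetric functions over [R]: symmetric of bounded degree. *)
Definition symfun (f : mfps nat R) :=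
  msymmetric f /\ exists d, forall m : {mset nat}, (d < size m)%N -> f@_m = 0.

(* [s] is the sum of the family [F], which has finite support. *)
Definition finite_sum (T : choiceType) (V : nmodType) (F : T -> V) (s : V) :=
  exists2 A : {fset T}, forall i, i \notin A -> F i = 0 & s = \sum_(i <- A) F i.

(* Infinite sums and products converge coefficientwise: every coefficient is
   that of all sufficiently large finite partial sums (products). *)
Definition formal_sum (T I : choiceType) (F : T -> mfps I R) (s : mfps I R) :=
  forall m, finite_sum (fun i => (F i)@_m) s@_m.

Definition formal_prod (T I : choiceType) (F : T -> mfps I R) (s : mfps I R) :=
  forall m, exists A : {fset T}, forall B : {fset T},
    fsubset A B -> (\prod_(i <- B) F i)@_m = s@_m.

End Operations.

Section FormalGroupLaw.
Variables (R : comNzRingType) (a : nat -> nat -> R) (I : choiceType).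
Implicit Types f g : mfps I R.

(* f +_F g, where F(u,v) = u + v + \sum_(i, j >= 1) a_{i,j} u^i v^j, for f and g
   without constant term: then f^i g^j only has monomials of degree >= i + j,
   which justifies the bounds of the sums. *)
Definition fgl_add f g : mfps I R :=
  MFPS (fun m => f@_m + g@_m +
    \sum_(1 <= i < (size m).+1) \sum_(1 <= j < (size m).+1)
      a i j * (f ^+ i * g ^+ j)@_m).

(* The formal inverse: the unique g without constant term such that
   f +_F g = 0. *)
Definition fgl_opp f : mfps I R :=
  xget 0 [set g | g@_mset0 = 0 /\ fgl_add f g = 0].

Definition fgl_kernel f g : mfps I R := (1 - fgl_opp f * g) / (1 - f * g).

End FormalGroupLaw.

(* Only the [a i j] with [i, j >= 1] matter; F(u,0) = u and F(0,v) = v are built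
   in the shape of F. *)
Definition fgl (R : comNzRingType) (a : nat -> nat -> R) :=
  (forall i j, (0 < i)%N -> (0 < j)%N -> a i j = a j i) /\
  let u := mvar R 0%N in let v := mvar R 1%N in let w := mvar R 2%N in
  fgl_add a (fgl_add a u v) w = fgl_add a u (fgl_add a v w).

Definition fgl_map (R S : comNzRingType) (a : nat -> nat -> R)
    (b : nat -> nat -> S) (h : {rmorphism R -> S}) :=
  forall i j, (0 < i)%N -> (0 < j)%N -> h (a i j) = b i j.

Definition universal_fgl (L : comNzRingType) (a : nat -> nat -> L) :=
  fgl a /\
  forall (S : comNzRingType) (b : nat -> nat -> S), fgl b ->
    exists2 h : {rmorphism L -> S}, fgl_map a b h &
      forall h' : {rmorphism L -> S}, fgl_map a b h' -> h' =1 h.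

Definition strict_partition := {l : seq nat | sorted gtn l && (0%N \notin l)}.
HB.instance Definition _ := Choice.on strict_partition.

(* Parts are numbered from 0. *)
Definition part (l : strict_partition) (i : nat) : nat := nth 0%N (val l) i.
Definition plen (l : strict_partition) : nat := size (val l).

Local Notation "x %:F" := (FracField.tofrac x).

(* The Lazard ring is an integral domain (Lazard's theorem), hence so is
   L[[x_1,...,x_n]], and the defining formulas of P and Q are read in its field
   of fractions. *)
Section PQ.
Variables (L : idomainType) (a : nat -> nat -> L).

(* The symmetrization common to P and Q: the monomial part is the product of
   the [F i (x_i)] over the first [plen l] indices. *)
Definition symmetrization (l : strict_partition) (n : nat)
    (F : nat -> mfps 'I_n L -> mfps 'I_n L) : {fraction mfps 'I_n L} :=
  if (n < plen l)%N then 0 else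
  ((n - plen l)`!%:R)^-1 * \sum_(w : 'S_n)
    let x (i : 'I_n) : mfps 'I_n L := mvar L (w i) in
    (\prod_(i < n | (i < plen l)%N) F i (x i))%:F *
    \prod_(i < n | (i < plen l)%N) \prod_(j < n | (i < j)%N)
      ((fgl_add a (x i) (x j))%:F / (fgl_add a (x i) (fgl_opp a (x j)))%:F).

Definition Pn (l : strict_partition) (n : nat) : {fraction mfps 'I_n L} :=
  @symmetrization l n (fun i x => x ^+ part l i).

Definition Qn (l : strict_partition) (n : nat) : {fraction mfps 'I_n L} :=
  @symmetrization l n (fun i x => fgl_add a x x * x ^+ (part l i).-1).

Definition xrestr (n : nat) : mfps nat L -> mfps 'I_n L :=
  mrestr (val : 'I_n -> nat).

(* P_l(x) and Q_l(x) as inverse limits along x_{n+1} = 0: the series whose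
   restriction to x_1,...,x_n is given by the n-variable formula for all n. *)
Definition isP (l : strict_partition) (p : mfps nat L) :=
  forall n, (xrestr n p)%:F = Pn l n.

Definition isQ (l : strict_partition) (q : mfps nat L) :=
  forall n, (xrestr n q)%:F = Qn l n.

End PQ.

Section Dual.
Variables (L : idomainType) (a : nat -> nat -> L).

Local Notation t := (mvar L (inl tt : unit + nat)).
Local Notation y j := (mvar L (inr j : unit + nat)).
Local Notation x2 i := (mvar L (inl i : nat + nat)).
Local Notation y2 j := (mvar L (inr j : nat + nat)).

(* [qk k] is \hat q_k(y) for k >= 0 and [pk k] is \hat p_k(y) for k >= 1: with
   K the product over j of (1 - \bar t y_j) / (1 - t y_j),
   K = \sum_k (qk k) t^k = 1 + (t +_F t) \sum_(k >= 1) (pk k) t^(k-1). *)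
Definition one_row_duals (pk qk : nat -> mfps nat L) :=
  (forall k, symfun (qk k)) /\ (forall k, (0 < k)%N -> symfun (pk k)) /\
  exists K S : mfps (unit + nat)%type L,
    [/\ formal_prod (fun j : nat => fgl_kernel a t (y j)) K,
        formal_sum (fun k : nat => mtens (mvar L tt ^+ k) (qk k)) K,
        formal_sum (fun k : nat => mtens (mvar L tt ^+ k) (pk k.+1)) S
      & K = 1 + fgl_add a t t * S].

(* The L-subalgebra generated by the [g k], [k >= 1]. *)
Definition in_subalg (g : nat -> mfps nat L) (f : mfps nat L) :=
  forall S : {pred mfps nat L}, GRing.subalg_closed S ->
    (forall k, (0 < k)%N -> g k \in S) -> f \in S.

(* The product over i, j of (1 - \bar x_i y_j) / (1 - x_i y_j) expands as
   \sum_l f_l(x) fdual_l(y); \hat p_l(y) is the dual of f = Q, and \hat q_l(y)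
   that of f = P. *)
Definition cauchy_expansion (f fdual : strict_partition -> mfps nat L) :=
  exists2 K : mfps (nat + nat)%type L,
    formal_prod (fun ij : nat * nat => fgl_kernel a (x2 ij.1) (y2 ij.2)) K &
    formal_sum (fun l => mtens (f l) (fdual l)) K.

End Dual.

(* Main.v *)
(* Let K(x; y) be the Cauchy kernel, the product of all k(x_i, y_j). The product
   over two sets of variables splits: K(x; y, y') = K(x; y) K(x; y') and
   K(x, x'; y) = K(x; y) K(x'; y). Substituting K = \sum_l f_l(x) fd_l(y), with
   f = P or Q, and expanding f_l f_k (resp. the coproduct of f_n) in the f's, the
   duality follows by comparing the coefficients of f_n(x), resp. of
   f_l(x) f_k(x').

   This comparison needs f to be formally free, and the finiteness of the sums
   needs f_l to start in degree |l|. Both follow from a leading term: order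
   monomials by degree, then by preferring more x_1, then more x_2, and so on.
   After multiplication by D = \prod_(i != j) (x_i +_F \bar x_j) the summand of w
   in the definition of f_l(x_1, ..., x_n) becomes a product of series with leading
   terms +- x_min(i, j), or multiples of x_(w i) ^ l_i. Its leading monomial is
   thus that of D times \prod_i x_(w i) ^ l_i, which is smallest when w fixes the
   indices of the nonzero parts of l, and then the coefficients all agree and do
   not cancel: n > 0 is nonzero in the Lazard ring, which maps to the integers
   through the additive formal group law. *)
From HB Require Import structures.
Require Import Defs.
From mathcomp Require Import all_boot all_order all_fingroup all_algebra.
From mathcomp Require Import finmap multiset zify.
From mathcomp Require Import boolp classical_sets cardinality fsbigop.

Set Implicit Arguments.
Unset Strict Implicit.
Unset Printing Implicit Defensive.

Import GRing.Theory.
Local Open Scope fset_scope.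
Local Open Scope classical_set_scope.
Local Open Scope ring_scope.
Local Open Scope mset_scope.

(** * Monomials and coefficients *)

Section Multisets.
Variables (K : choiceType).
Implicit Types (a b m : {mset K}).

Lemma size_msetD a b : size (a `+` b) = (size a + size b)%N.
Proof.
rewrite -size_cat; apply: perm_size; apply/allP => x _ /=.
by rewrite count_cat !count_mem_mset msetE2.
Qed.

Lemma size_mset1 (x : K) : size [mset x] = 1%N.
Proof. by rewrite enum_msetn. Qed.

Lemma size_msetB a m : msubset a m -> size (m `\` a) = (size m - size a)%N.
Proof. by move=> am; rewrite -{2}(msetBDKC am) size_msetD addKn. Qed.

Lemma size_msubset a m : msubset a m -> (size a <= size m)%N.
Proof. by move=> am; rewrite -(msetBDKC am) size_msetD leq_addr. Qed.

Lemma msubsetBl a m : msubset (m `\` a) m.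
Proof. by apply/msubsetP => i; rewrite msetE2 leq_subr. Qed.

Lemma msubset_addl a b : msubset a (a `+` b).
Proof. by apply/msubsetP => i; rewrite msetE2 leq_addr. Qed.

Lemma size0_mset0 m : size m = 0%N -> m = mset0.
Proof. by move/eqP; rewrite size_mset_eq0 => /eqP. Qed.

Lemma mset_size1 m : size m = 1%N -> exists x, m = [mset x].
Proof.
move=> sm; have : m != mset0 by rewrite -size_mset_eq0 sm.
case: (mset_0Vmem m) => [->|[x xm] _]; first by rewrite eqxx.
exists x; rewrite -(msetB1K xm).
rewrite [X in _ `+` X]size0_mset0 ?msetD0// size_msetB ?msub1set//.
by rewrite sm size_mset1.
Qed.

End Multisets.

Section Coefficients.
Variables (I : choiceType) (R : comNzRingType).
Implicit Types (f g h : mfps I R) (a b m : {mset I}).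

Lemma mcoef0 m : (0 : mfps I R)@_m = 0.
Proof. by rewrite /= if_same. Qed.

Lemma mcoef1 m : (1 : mfps I R)@_m = (m == mset0)%:R.
Proof. by rewrite /=; case: eqP. Qed.

Lemma mcoefD f g m : (f + g)@_m = f@_m + g@_m. Proof. by []. Qed.
Lemma mcoefN f m : (- f)@_m = - f@_m. Proof. by []. Qed.
Lemma mcoefZ (x : R) f m : (x *: f)@_m = x * f@_m. Proof. by []. Qed.

Lemma mcoef_sum (T : Type) (s : seq T) (P : pred T) (F : T -> mfps I R) m :
  (\sum_(i <- s | P i) F i)@_m = \sum_(i <- s | P i) (F i)@_m.
Proof. exact: (big_morph (fun f => f@_m) (fun f g => mcoefD f g m) (mcoef0 m)). Qed.

Lemma mcoefMn f (k : nat) m : (f *+ k)@_m = f@_m *+ k.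
Proof. by elim: k => [|k IHk]; rewrite ?mulr0n ?mcoef0// !mulrS mcoefD IHk. Qed.

Lemma eq_mcoefM f f' g g' m :
  (forall a, msubset a m -> f@_a * g@_(m `\` a) = f'@_a * g'@_(m `\` a)) ->
  (f * g)@_m = (f' * g')@_m.
Proof. by move=> e; rewrite !mcoefM; apply: eq_fsbigr => a; rewrite inE => /e. Qed.

Lemma mcoefM_eq0 f g m :
  (forall a, msubset a m -> f@_a * g@_(m `\` a) = 0) -> (f * g)@_m = 0.
Proof. by move=> e; rewrite mcoefM; apply: fsbig1 => a /= /e. Qed.

Lemma mcoefM_single f g m a : msubset a m ->
  (forall b, msubset b m -> b <> a -> f@_b * g@_(m `\` b) = 0) ->
  (f * g)@_m = f@_a * g@_(m `\` a).
Proof.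
move=> am e; rewrite mcoefM (fsbigD1 a)//=; last first.
  by apply: sub_finite_set (finite_msubset m) => b [].
by rewrite fsbig1 ?addr0// => b [bm /= ba]; exact: e.
Qed.

Lemma mcoefM0 f g : (f * g)@_mset0 = f@_mset0 * g@_mset0.
Proof.
rewrite (@mcoefM_single _ _ _ mset0) ?msubset_refl ?msetB0// => b.
by rewrite msubset0 => /eqP.
Qed.

Lemma mcoef_exp0 f k : f@_mset0 = 0 -> (0 < k)%N -> (f ^+ k)@_mset0 = 0.
Proof. by case: k => // k f0 _; rewrite exprS mcoefM0 f0 mul0r. Qed.

(** Contraction for the filtration by total degree: the equation [Phi f = f] can then be solved
    degree by degree, even in infinitely many variables. *)
Definition contractive (Phi : mfps I R -> mfps I R) := forall f g m,
  (forall m', (size m' < size m)%N -> f@_m' = g@_m') -> (Phi f)@_m = (Phi g)@_m.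

Lemma contractive_fixpoint Phi : contractive Phi -> exists f, Phi f = f.
Proof.
move=> ctr; pose it k := iter k Phi 0.
have it_eq k l m : (size m < k)%N -> (size m < l)%N -> (it k)@_m = (it l)@_m.
  elim: k l m => [|k IHk] [|l] m //= mk ml; apply: ctr => m' m'm.
  by apply: IHk; lia.
(* The coefficient at [m] no longer changes from the iterate [(size m).+1] on, so it is read
   there. *)
exists (MFPS (fun m => (it (size m).+1)@_m)); apply/mfpsP => m /=.
by apply: ctr => m' m'm /=; apply: (it_eq (size m').+1).
Qed.

Lemma contractive_unique Phi f g :
  contractive Phi -> Phi f = f -> Phi g = g -> f = g.
Proof.
move=> ctr fE gE; apply/mfpsP => m; have [k mk] := ubnP (size m).
elim: k m mk => // k IHk m mk; rewrite -fE -gE; apply: ctr => m' m'm.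
by apply: IHk; lia.
Qed.

(* The inverse of 1 - h is the fixed point of g |-> 1 + h g. *)
Lemma unit_1sub h : h@_mset0 = 0 -> 1 - h \is a GRing.unit.
Proof.
move=> h0; have [|g gE] := @contractive_fixpoint (fun g => 1 + h * g).
  move=> f g m fg; rewrite !mcoefD; congr (_ + _); apply: eq_mcoefM => a am.
  have [->|a0] := eqVneq a mset0; first by rewrite h0 !mul0r.
  rewrite fg// size_msetB//; move: a0 (size_msubset am).
  by rewrite -size_mset_eq0; lia.
apply/unitrPr; exists g.
by rewrite mulrBl mul1r -{1}gE addrK.
Qed.

End Coefficients.

(** * The formal inverse *)

Section FormalInverse.
Variables (R : comNzRingType) (a : nat -> nat -> R) (I : choiceType).
Implicit Types (f g : mfps I R) (b m : {mset I}).

Lemma eq_mcoef_exp f g k : (forall m, (size m < k)%N -> f@_m = g@_m) ->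
  forall j m, (size m < k)%N -> (f ^+ j)@_m = (g ^+ j)@_m.
Proof.
move=> fg; elim=> [|j IHj] m mk; first by rewrite !expr0.
rewrite !exprS; apply: eq_mcoefM => b bm; have := size_msubset bm.
have := size_msubset (msubsetBl b m) => bm1 bm2.
by rewrite fg ?IHj//; lia.
Qed.

(** The equation f +_F g = 0 solved for its linear term in g. *)
Let Phi f g : mfps I R := MFPS (fun m => - f@_m -
  \sum_(1 <= i < (size m).+1) \sum_(1 <= j < (size m).+1) a i j * (f ^+ i * g ^+
    j)@_m).

Let PhiP f g : Phi f g = g <-> fgl_add a f g = 0.
Proof.
split=> e; apply/mfpsP => m; have := congr1 (fun h : mfps I R => h@_m) e.
  by rewrite mcoef0 /= => <-; rewrite addrA addrN sub0r addNr.
rewrite mcoef0 /= => /eqP; rewrite addrAC [_ + g@_m]addrC addr_eq0 => /eqP ->.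
by rewrite opprD.
Qed.

(** Every g^j comes with a factor f^i, i >= 1, without constant term, so the coefficient at [m] only
    sees g in degrees below that of [m]. *)
Let Phi_contractive f : f@_mset0 = 0 -> contractive (Phi f).
Proof.
move=> f0 g h m gh /=; congr (_ - _).
rewrite big_nat [RHS]big_nat; apply: eq_bigr => i /andP[i0 _].
apply: eq_bigr => j _; congr (_ * _); apply: eq_mcoefM => b bm.
have [->|b0] := eqVneq b mset0; first by rewrite mcoef_exp0// !mul0r.
rewrite (eq_mcoef_exp gh)// size_msetB//; move: b0 (size_msubset bm).
by rewrite -size_mset_eq0; lia.
Qed.

Lemma fgl_addE f g m : (fgl_add a f g)@_m = f@_m + g@_m +
  \sum_(1 <= i < (size m).+1) \sum_(1 <= j < (size m).+1)
    a i j * (f ^+ i * g ^+ j)@_m.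
Proof. by []. Qed.

Lemma fgl_add_coef0 f g : (fgl_add a f g)@_mset0 = f@_mset0 + g@_mset0.
Proof. by rewrite /= size_mset0 big_geq// addr0. Qed.

(** [xget] falls back to its default only when there is no formal inverse, and the fixed point of
    [Phi] is one. *)
Lemma fgl_oppP f : f@_mset0 = 0 ->
  (fgl_opp a f)@_mset0 = 0 /\ fgl_add a f (fgl_opp a f) = 0.
Proof.
move=> f0; rewrite /fgl_opp; case: xgetP => [g _ //|noinv].
have [g /PhiP gE] := contractive_fixpoint (Phi_contractive f0).
case: (noinv g); split=> //.
by rewrite -[LHS]add0r -{1}f0 -fgl_add_coef0 gE mcoef0.
Qed.

Lemma fgl_opp_unique f g : f@_mset0 = 0 -> fgl_add a f g = 0 -> fgl_opp a f = g.
Proof.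
move=> f0 /PhiP gE; have [_ /PhiP oE] := fgl_oppP f0.
exact: contractive_unique (Phi_contractive f0) oE gE.
Qed.

(** The mixed terms of the formal group law start in degree 2. *)
Lemma fgl_add_coef1 f g (x : I) : f@_mset0 = 0 -> g@_mset0 = 0 ->
  (fgl_add a f g)@_[mset x] = f@_[mset x] + g@_[mset x].
Proof.
move=> f0 g0; rewrite fgl_addE size_mset1 !big_nat1 !expr1 mcoefM_eq0 ?mulr0 ?addr0//.
move=> b bx; have [->|b0] := eqVneq b mset0; first by rewrite f0 mul0r.
have -> : [mset x] `\` b = mset0; last by rewrite g0 mulr0.
apply: size0_mset0; rewrite size_msetB// size_mset1.
by move: b0; rewrite -size_mset_eq0; lia.
Qed.

Lemma fgl_opp_coef1 f (x : I) : f@_mset0 = 0 ->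
  (fgl_opp a f)@_[mset x] = - f@_[mset x].
Proof.
move=> f0; have [o0 /(congr1 (fun h => h@_[mset x]))] := fgl_oppP f0.
by rewrite fgl_add_coef1// mcoef0 addrC => /eqP; rewrite addr_eq0 => /eqP.
Qed.

End FormalInverse.

(** * Changes of variables *)

Section Renaming.
Variables (I J : choiceType) (iota : I -> J).
Implicit Types (m : {mset I}) (M : {mset J}).

Lemma size_mrename m : size (mrename iota m) = size m.
Proof. by rewrite (perm_size (perm_eq_seq_mset _)) size_map. Qed.

Lemma mrenameD a b : mrename iota (a `+` b) = mrename iota a `+` mrename iota b.
Proof.
apply/msetP => j; rewrite msetE2 !mset_seqE -count_cat -map_cat.
apply: (seq.permP _ (pred1 j)); apply: perm_map; apply/allP => x _ /=.
by rewrite count_cat !count_mem_mset msetE2.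
Qed.

Lemma mrename0 : mrename iota mset0 = mset0.
Proof. by apply: size0_mset0; rewrite size_mrename size_mset0. Qed.

Lemma mrename1 i : mrename iota [mset i] = [mset iota i].
Proof.
apply/msetP => j; rewrite mset_seqE enum_msetn /= msetnE eq_sym.
by case: eqP.
Qed.

Lemma mrename_notin m j : (forall i, iota i <> j) -> mrename iota m j = 0%N.
Proof.
move=> nj; rewrite mset_seqE; apply/count_memPn/mapP => -[i _ ji].
exact: nj (esym ji).
Qed.

Lemma mrename_surj M : (forall j, j \in M -> exists i, j = iota i) ->
  exists m, M = mrename iota m.
Proof.
move=> Miota; suff [s sM] : exists s, map iota s = M.
  exists (seq_mset s); rewrite -[LHS]seq_mset_id; apply/eq_seq_msetP.
  by rewrite -sM perm_sym; apply/perm_map/perm_eq_seq_mset.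
have : forall j, j \in enum_mset M -> exists i, j = iota i by exact: Miota.
elim: (enum_mset M) => [|j s IHs] Mi; first by exists [::].
have [i ->] := Mi j (mem_head _ _).
have [|t <-] := IHs; last by exists (i :: t).
by move=> k ks; apply: Mi; rewrite inE ks orbT.
Qed.

Hypothesis iota_inj : injective iota.

Lemma mrenameE m i : mrename iota m (iota i) = m i.
Proof.
rewrite mset_seqE count_map -count_mem_mset; apply: eq_count => k /=.
exact: inj_eq.
Qed.

Lemma mrename_inj : injective (mrename iota).
Proof. by move=> a b ab; apply/msetP => i; rewrite -!mrenameE ab. Qed.

Lemma msubset_mrename a b :
  msubset (mrename iota a) (mrename iota b) = msubset a b.
Proof.
apply/msubsetP/msubsetP => ab i; first by rewrite -!mrenameE ab.
have [[k ->]|/forallNP ni] := pselect (exists k, i = iota k).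
  by rewrite !mrenameE.
by rewrite !mrename_notin// => k /esym /ni.
Qed.

Lemma sub_mrename m M : msubset M (mrename iota m) ->
  exists2 a, msubset a m & M = mrename iota a.
Proof.
move=> Mm; have [|a Ma] := @mrename_surj M; last first.
  by exists a; rewrite // -msubset_mrename -Ma.
move=> j; rewrite -mset_gt0 => jM; apply: contrapT => /forallNP nj.
have := msubsetP Mm j; rewrite mrename_notin; first by rewrite leqNgt jM.
by move=> i /esym /nj.
Qed.

Lemma mrenameB m a : msubset a m ->
  mrename iota (m `\` a) = mrename iota m `\` mrename iota a.
Proof.
move=> am; rewrite -{2}(msetBDKC am) mrenameD.
by apply/msetP => j; rewrite !msetE2 addKn.
Qed.

End Renaming.

Section Relabeling.
Variable (R : comNzRingType).

(* What [mrestr iota] and [mext iota] have in common, for an injective [iota]. *)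
Definition relabeling (I J : choiceType) (H : mfps I R -> mfps J R) :=
  [/\ forall M, (forall f, (H f)@_M = 0) \/
        exists2 m : {mset I}, size m = size M & forall f, (H f)@_M = f@_m,
      {morph H : f g / f * g} & H 1 = 1].

Section Theory.
Variables (I J : choiceType) (H : mfps I R -> mfps J R).
Hypothesis relH : relabeling H.
Implicit Types (f g : mfps I R).

Let relc M : (forall f, (H f)@_M = 0) \/
  exists2 m : {mset I}, size m = size M & forall f, (H f)@_M = f@_m.
Proof. by case: relH. Qed.

Lemma relabelingM : {morph H : f g / f * g}. Proof. by case: relH. Qed.
Lemma relabeling1 : H 1 = 1. Proof. by case: relH. Qed.

Lemma relabelingD : {morph H : f g / f + g}.
Proof.
move=> f g; apply/mfpsP => M; rewrite mcoefD.
by have [H0|[m _ Hm]] := relc M; rewrite ?H0 ?addr0// !Hm.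
Qed.

Lemma relabeling0 : H 0 = 0.
Proof.
apply/mfpsP => M; rewrite mcoef0.
by have [H0|[m _ Hm]] := relc M; rewrite ?H0// Hm mcoef0.
Qed.

Lemma relabelingN : {morph H : f / - f}.
Proof.
move=> f; apply/mfpsP => M; rewrite mcoefN.
by have [H0|[m _ Hm]] := relc M; rewrite ?H0 ?oppr0// !Hm.
Qed.

Lemma relabelingX f n : H (f ^+ n) = H f ^+ n.
Proof. by elim: n => [|n IHn]; rewrite ?relabeling1// !exprS relabelingM IHn. Qed.

Lemma relabeling_prod (T : Type) (s : seq T) (P : pred T) (F : T -> mfps I R) :
  H (\prod_(i <- s | P i) F i) = \prod_(i <- s | P i) H (F i).
Proof. exact: (big_morph H relabelingM relabeling1). Qed.

Lemma relabeling_sum (T : Type) (s : seq T) (P : pred T) (F : T -> mfps I R) :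
  H (\sum_(i <- s | P i) F i) = \sum_(i <- s | P i) H (F i).
Proof. exact: (big_morph H relabelingD relabeling0). Qed.

Lemma relabeling_coef0 f : f@_mset0 = 0 -> (H f)@_mset0 = 0.
Proof.
move=> f0; have [->//|[m m0 ->]] := relc mset0.
by rewrite (size0_mset0 (etrans m0 size_mset0)).
Qed.

Variable (a : nat -> nat -> R).

Lemma relabeling_fgl_add f g : H (fgl_add a f g) = fgl_add a (H f) (H g).
Proof.
apply/mfpsP => M; rewrite fgl_addE.
under eq_bigr do under eq_bigr do rewrite -!relabelingX -relabelingM.
have [H0|[m mM Hm]] := relc M; last first.
  rewrite !Hm fgl_addE mM; congr (_ + _); apply: eq_bigr => i _.
  by apply: eq_bigr => j _; rewrite Hm.
rewrite !H0 !add0r big1// => i _; rewrite big1// => j _.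
by rewrite H0 mulr0.
Qed.

(** The image of the formal inverse satisfies the equation that characterizes the formal inverse of
    [H f]. *)
Lemma relabeling_fgl_opp f : f@_mset0 = 0 -> H (fgl_opp a f) = fgl_opp a (H f).
Proof.
move=> f0; apply/esym/fgl_opp_unique; first exact: relabeling_coef0.
by rewrite -relabeling_fgl_add; have [_ ->] := fgl_oppP a f0; rewrite relabeling0.
Qed.

(** Relabelings respect all ingredients of the kernel; the quotient is handled by multiplying with
    its denominator, a unit because f and g have no constant term. *)
Lemma relabeling_fgl_kernel f g (f' g' : mfps J R) : f@_mset0 = 0 -> g@_mset0 = 0 ->
  H f = f' -> H g = g' -> H (fgl_kernel a f g) = fgl_kernel a f' g'.
Proof.
move=> f0 g0 <- <-; rewrite /fgl_kernel.
have fgU : 1 - f * g \is a GRing.unit by rewrite unit_1sub// mcoefM0 f0 mul0r.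
apply: (@mulIr _ (1 - H f * H g)).
  by rewrite unit_1sub// mcoefM0 relabeling_coef0// mul0r.
rewrite divrK; last by rewrite unit_1sub// mcoefM0 relabeling_coef0// mul0r.
rewrite -relabelingM -[X in X - H _]relabeling1 -relabelingN -relabelingD.
rewrite -relabelingM divrK// relabelingD relabeling1 relabelingN relabelingM.
by rewrite relabeling_fgl_opp.
Qed.

End Theory.

Section Restriction.
Variables (I J : choiceType) (iota : I -> J).
Hypothesis iota_inj : injective iota.

(** The divisors of a renamed monomial are exactly the renamed divisors, which makes restriction
    multiplicative. *)
Lemma fsbig_mrename (G : {mset J} -> R) (m : {mset I}) :
  \sum_(b \in [set b : {mset J} | msubset b (mrename iota m)]) G b =
  \sum_(b \in [set b : {mset I} | msubset b m]) G (mrename iota b).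
Proof.
apply: reindex_fsbig; split=> [b /= bm|b c _ _|b /= /(sub_mrename iota_inj)].
- by rewrite msubset_mrename.
- exact: mrename_inj.
- by case=> c cm ->; exists c.
Qed.

Lemma relabeling_mrestr : relabeling (@mrestr R I J iota).
Proof.
split=> [M|f g|].
- by right; exists (mrename iota M); rewrite ?size_mrename.
- apply/mfpsP => m; rewrite mcoefM /= fsbig_mrename; apply: eq_fsbigr => b.
  by rewrite inE /= => bm; rewrite mrenameB.
- apply/mfpsP => m; rewrite mcoef1 /= -(mrename0 iota).
  by rewrite (inj_eq (mrename_inj iota_inj)); case: eqP.
Qed.

Lemma mrestr_mvar i : mrestr iota (mvar R (iota i)) = mvar R i.
Proof.
apply/mfpsP => m /=; rewrite -mrename1.
by rewrite (inj_eq (mrename_inj iota_inj)).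
Qed.

End Restriction.

(* For an injective [iota]: rename each variable [i] to [iota i]. *)
Definition mext (I J : choiceType) (iota : I -> J) (f : mfps I R) : mfps J R :=
  MFPS (fun M => if `[< exists m, M = mrename iota m >]
    then f@_(xget mset0 [set m | M = mrename iota m]) else 0).

Section Extension.
Variables (I J : choiceType) (iota : I -> J).
Hypothesis iota_inj : injective iota.

Lemma mextE f m : (mext iota f)@_(mrename iota m) = f@_m.
Proof.
rewrite /= ifT; last by apply/asboolP; exists m.
case: xgetP => [b _ /(mrename_inj iota_inj) -> //|/(_ m)].
by case.
Qed.

Lemma mext_notin f M : (forall m, M <> mrename iota m) -> (mext iota f)@_M = 0.
Proof. by move=> nM; rewrite /= ifF//; apply/asboolP => -[m /nM]. Qed.

Lemma relabeling_mext : relabeling (@mext I J iota).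
Proof.
have imP M : (exists m, M = mrename iota m) \/ (forall m, M <> mrename iota m).
  by have [|/forallNP] := pselect (exists m, M = mrename iota m); [left|right].
split=> [M|f g|].
- have [[m ->]|nM] := imP M; last by left=> f; exact: mext_notin.
  by right; exists m => [|f]; rewrite ?size_mrename ?mextE.
- apply/mfpsP => M; have [[m ->]|nM] := imP M.
    rewrite mextE (mcoefM f g) (mcoefM (mext _ f)) [RHS](fsbig_mrename iota_inj);
      apply: eq_fsbigr => b.
    by rewrite inE => bm; rewrite -(mrenameB iota bm) (mextE f) (mextE g).
  rewrite mext_notin// mcoefM_eq0// => b bM.
  have [[c bc]|nb] := imP b; last by rewrite mext_notin ?mul0r.
  rewrite [X in _ * X]mext_notin ?mulr0// => d Md; apply: (nM (c `+` d)).
  by rewrite mrenameD -bc -Md msetBDKC.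
- apply/mfpsP => M; have [[m ->]|nM] := imP M.
    rewrite mextE !mcoef1 -(mrename0 iota) (inj_eq (mrename_inj iota_inj)).
    by [].
  rewrite mext_notin// mcoef1; case: eqP => // M0; case: (nM mset0).
  by rewrite mrename0.
Qed.

Lemma mext_mvar i : mext iota (mvar R i) = mvar R (iota i).
Proof.
apply/mfpsP => M;
  have [[m ->]|/forallNP nM] := pselect (exists m, M = mrename iota m).
  by rewrite mextE /= -mrename1 (inj_eq (mrename_inj iota_inj)).
rewrite mext_notin//=; case: eqP => // M1; case: (nM [mset i]).
by rewrite mrename1.
Qed.

End Extension.

Lemma mrename_comp (I J K : choiceType) (f : J -> K) (g : I -> J) m :
  mrename (f \o g) m = mrename f (mrename g m).
Proof.
apply/eq_seq_msetP; rewrite (map_comp f g) perm_sym.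
exact/perm_map/perm_eq_seq_mset.
Qed.

Lemma mext_comp (I J K : choiceType) (f : J -> K) (g : I -> J) h :
  injective f -> injective g -> mext f (mext g h) = mext (f \o g) h.
Proof.
move=> fI gI; apply/mfpsP => M.
have [[m ->]|/forallNP nM] := pselect (exists m, M = mrename (f \o g) m).
  by rewrite [RHS](mextE (inj_comp fI gI)) (mrename_comp f g) (mextE fI) (mextE gI).
rewrite [RHS](mext_notin _ nM).
have [[m Mm]|/forallNP nM'] := pselect (exists m, M = mrename f m);
  last exact: mext_notin.
rewrite Mm (mextE fI); apply: mext_notin => b mb; apply: (nM b).
by rewrite mrename_comp -mb.
Qed.

End Relabeling.

(** * Products in disjoint sets of variables *)

Section Tensor.
Variables (I J : choiceType) (R : comNzRingType).
Implicit Types (M : {mset (I + J)%type}).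

Lemma minlE M i : minl M i = M (inl i).
Proof.
rewrite mset_seqE -count_mem_mset; elim: (enum_mset M) => //= -[k|k] s /= <-//.
Qed.

Lemma minrE M j : minr M j = M (inr j).
Proof.
rewrite mset_seqE -count_mem_mset; elim: (enum_mset M) => //= -[k|k] s /= <-//.
Qed.

Lemma inl_inj : injective (@inl I J). Proof. by move=> x y []. Qed.
Lemma inr_inj : injective (@inr I J). Proof. by move=> x y []. Qed.

Lemma minlD M N : minl (M `+` N) = minl M `+` minl N.
Proof. by apply/msetP => i; rewrite !(minlE, msetE2). Qed.

Lemma minrD M N : minr (M `+` N) = minr M `+` minr N.
Proof. by apply/msetP => i; rewrite !(minrE, msetE2). Qed.

Lemma minl_inl m : minl (mrename (@inl I J) m) = m.
Proof. by apply/msetP => i; rewrite minlE mrenameE//; exact: inl_inj. Qed.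

Lemma minl_inr m : minl (mrename (@inr I J) m) = mset0.
Proof. by apply/msetP => i; rewrite minlE mrename_notin// mset0E. Qed.

Lemma minr_inr m : minr (mrename (@inr I J) m) = m.
Proof. by apply/msetP => i; rewrite minrE mrenameE//; exact: inr_inj. Qed.

Lemma minr_inl m : minr (mrename (@inl I J) m) = mset0.
Proof. by apply/msetP => i; rewrite minrE mrename_notin// mset0E. Qed.

Definition munion (m : {mset I}) (m' : {mset J}) : {mset (I + J)%type} :=
  mrename inl m `+` mrename inr m'.

Lemma minl_union m m' : minl (munion m m') = m.
Proof. by rewrite minlD minl_inl minl_inr msetD0. Qed.

Lemma minr_union m m' : minr (munion m m') = m'.
Proof. by rewrite minrD minr_inl minr_inr mset0D. Qed.

Lemma munionK M : munion (minl M) (minr M) = M.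
Proof.
apply/msetP => -[i|j]; rewrite msetE2.
  by rewrite (mrenameE inl_inj) mrename_notin ?minlE ?addn0.
by rewrite (mrenameE inr_inj) [X in (X + _)%N]mrename_notin ?minrE.
Qed.

(** A monomial factors in only one way into a left and a right part, so the product on the right has
    a single term. This reduces [mtens] to ring operations and relabelings. *)
Lemma mtensE (f : mfps I R) (g : mfps J R) :
  mtens f g = mext inl f * mext inr g.
Proof.
apply/mfpsP => M; have ME := munionK M.
have aM : msubset (mrename inl (minl M)) M by rewrite -[X in msubset _ X]ME
  msubset_addl.
rewrite (mcoefM_single aM) => [|b bM bE].
  have -> : M `\` mrename inl (minl M) = mrename inr (minr M).
    by rewrite -[X in X `\` _]ME; apply/msetP => i; rewrite !msetE2 addKn.
  by rewrite (mextE inl_inj) (mextE inr_inj).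
have [[c bc]|/forallNP nb] := pselect (exists c, b = mrename inl c); last first.
  by rewrite (mext_notin f nb) mul0r.
rewrite [X in _ * X]mext_notin ?mulr0// => d Md; apply: bE.
rewrite bc; congr mrename; rewrite -(msetBDKC bM) Md bc.
exact/esym/minl_union.
Qed.

Lemma size_munion m m' : size (munion m m') = (size m + size m')%N.
Proof. by rewrite size_msetD !size_mrename. Qed.

Lemma minl_sub M N : msubset M N -> msubset (minl M) (minl N).
Proof. by move/msubsetP=> MN; apply/msubsetP => i; rewrite !minlE. Qed.

End Tensor.

(** * Splitting a formal product *)

Section FormalProduct.
Variables (R : comNzRingType) (T I J : choiceType).

(** A coefficient of a product of two series involves all divisors of [M]. There are finitely many,
    so a single finite set of factors serves them all; it is enlarged one divisor at a time. *)
Lemma formal_prod_relabeling (F : T -> mfps I R) K (H : mfps I R -> mfps J R) M :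
  relabeling H -> formal_prod F K ->
  exists A : {fset T}, forall B : {fset T}, fsubset A B ->
    forall b, msubset b M -> (\prod_(t <- B) H (F t))@_b = (H K)@_b.
Proof.
move=> relH FK; suff /(_ (enum_fset (fset_set [set b | msubset b M])))[A AP] :
    forall s : seq {mset J}, exists A : {fset T}, forall B : {fset T}, fsubset A B ->
      {in s, forall b, (\prod_(t <- B) H (F t))@_b = (H K)@_b}.
  exists A => B AB b bM; apply: AP => //.
  by rewrite [_ \in _]in_fset_set ?inE//; exact: finite_msubset.
have := relH => -[Hc _ _]; elim=> [|b s [A IHA]]; first by exists fset0.
have [H0|[m _ Hm]] := Hc b.
  exists A => B AB c; rewrite inE => /predU1P[->|]; last exact: IHA.
  by rewrite -relabeling_prod// !H0.
have [A' A'P] := FK m; exists (A `|` A')%fset => B;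
  rewrite fsubUset => /andP[AB A'B] c.
rewrite inE => /predU1P[->|]; last exact: IHA.
by rewrite -relabeling_prod// !Hm A'P.
Qed.

(** The bijection [s] cuts the index set into two copies of itself. A finite partial product over
    equal pieces [C] of both copies factors, and for [C] large all three products have reached their
    limits at the divisors of [M]. *)
Lemma formal_prod_split (F : T -> mfps I R) K (G E1 E2 : mfps I R -> mfps J R)
    (s : T + T -> T) :
  relabeling G -> relabeling E1 -> relabeling E2 -> bijective s ->
  (forall t, G (F (s (inl t))) = E1 (F t)) ->
  (forall t, G (F (s (inr t))) = E2 (F t)) ->
  formal_prod F K -> G K = E1 K * E2 K.
Proof.
move=> relG rel1 rel2 [s' sK s'K] GE1 GE2 FK; apply/mfpsP => M.
have [A AP] := formal_prod_relabeling M relG FK.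
have [A1 A1P] := formal_prod_relabeling M rel1 FK.
have [A2 A2P] := formal_prod_relabeling M rel2 FK.
pose untag (u : T + T) := match u with inl t => t | inr t => t end.
(* Besides [A1] and [A2], [C] contains what is needed for its two copies under [s] to cover [A]. *)
pose C := (A1 `|` A2 `|` [fset untag (s' t) | t in A])%fset.
have [st stE] : exists st, st = [seq s (inl t) | t <- C] ++ [seq s (inr t) | t <- C].
  by eexists.
have st_uniq : uniq st.
  rewrite stE cat_uniq !map_inj_in_uniq ?fset_uniq//=; last 2 first.
  - by move=> t u _ _ /(can_inj sK) [].
  - by move=> t u _ _ /(can_inj sK) [].
  rewrite andbT; apply/hasPn => _ /mapP[u _ ->]; apply/mapP => -[v _].
  by move/(can_inj sK).
have AC : fsubset A [fset t in st].
  apply/fsubsetP => t tA; have : untag (s' t) \in C.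
    by rewrite inE; apply/orP; right; apply/imfsetP; exists t.
  move=> tC; rewrite inE stE mem_cat -(s'K t); case: (s' t) tC => u /= uC; apply/orP;
  by [left; apply: map_f|right; apply: map_f].
rewrite -(AP _ AC) ?msubset_refl//.
have -> : \prod_(t <- [fset t in st]) G (F t) =
    (\prod_(t <- C) E1 (F t)) * \prod_(t <- C) E2 (F t).
  rewrite (perm_big st); last by apply: uniq_perm; rewrite ?fset_uniq// => t;
    rewrite inE.
  rewrite stE big_cat !big_map /=.
  by congr (_ * _); apply: eq_bigr => t _; rewrite ?GE1 ?GE2.
apply: eq_mcoefM => b bM; rewrite A1P ?A2P ?msubsetBl//.
  by apply/fsubsetP => t tA; rewrite !inE tA orbT.
by apply/fsubsetP => t tA; rewrite !inE tA.
Qed.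

End FormalProduct.

HB.instance Definition _ (K : choiceType) :=
  Monoid.isComLaw.Build {mset K} mset0 msetD (@msetDA K) (@msetDC K) (@mset0D K).

(** * Leading terms *)

Section MonomialOrder.
Variable n : nat.
Implicit Types (m a b c d : {mset 'I_n}).

(** The degree in the variables from x_k on. [tail 0] is the total degree, and if [tail k] agrees on
    two monomials, a smaller [tail k.+1] means more of x_k; so one lexicographic comparison of tails
    encodes the whole order. *)
Definition tail (k : nat) m := (\sum_(j < n | (k <= j)%N) m j)%N.

(* Compare degrees first (lower is smaller), then prefer the monomial with more
   of x_0, then more of x_1, and so on. *)
Definition klt a b :=
  exists2 i, (tail i a < tail i b)%N & forall k, (k < i)%N -> tail k a = tail k b.

Definition kle a b := a = b \/ klt a b.

Lemma tailD k a b : tail k (a `+` b) = (tail k a + tail k b)%N.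
Proof. by rewrite /tail -big_split; apply: eq_bigr => j _; rewrite msetE2. Qed.

Lemma tail_0 m : tail 0 m = size m.
Proof.
rewrite size_mset /tail [RHS]big_uniq ?fset_uniq//= [RHS]big_mkcond /=.
apply: eq_bigr => j _; have [//|] := boolP (j \in finsupp m).
by rewrite msuppE -mset_eq0 => /eqP.
Qed.

Lemma tail_ge k m : (n <= k)%N -> tail k m = 0%N.
Proof. by move=> nk; rewrite /tail big_pred0// => j; have := ltn_ord j; lia. Qed.

Lemma tail_step (k : 'I_n) m : tail k m = (m k + tail k.+1 m)%N.
Proof.
rewrite /tail (bigD1 k)//=; congr addn; apply: eq_bigl => j.
by rewrite ltn_neqAle andbC eq_sym.
Qed.

Lemma tail_inj a b : (forall k, tail k a = tail k b) -> a = b.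
Proof.
move=> ab; apply/msetP => i; have := ab i.
by rewrite !tail_step ab => /addIn.
Qed.

Lemma tail_mset1 k (x : 'I_n) : tail k [mset x] = (k <= x)%N.
Proof.
rewrite /tail big_mkcond (bigD1 x)//= big1 => [|j jx].
  by rewrite msetnxx addn0; case: leqP.
by rewrite msetnE (negPf jx) if_same.
Qed.

Lemma klt_total a b : a <> b -> klt a b \/ klt b a.
Proof.
move=> ab; have ex : exists k, tail k a != tail k b.
  apply: contrapT => /forallNP e; apply: ab; apply: tail_inj => k.
  by apply/eqP; have /negP := e k; rewrite negbK.
case: (ex_minnP ex) => k kab kmin.
have eqk j : (j < k)%N -> tail j a = tail j b.
  by move=> jk; apply/eqP; apply: contraLR jk => /kmin; rewrite leqNgt.
move: kab; rewrite neq_ltn => /orP[|] lt; [left|right]; exists k => // j jk.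
by rewrite eqk.
Qed.

Lemma klt_irr a : ~ klt a a. Proof. by case=> i; rewrite ltnn. Qed.

Lemma klt_trans a b c : klt a b -> klt b c -> klt a c.
Proof.
move=> [i ab abE] [j bc bcE]; have [ij|ji|ij] := ltngtP i j.
- by exists i => [|k ki]; rewrite -?bcE// ?abE// ?bcE//; lia.
- by exists j => [|k kj]; rewrite ?abE// ?bcE//; lia.
- exists i => [|k ki]; first by rewrite (ltn_trans ab)// ij.
  by rewrite abE// bcE// -ij.
Qed.

Lemma klt_kle_trans a b c : klt a b -> kle b c -> klt a c.
Proof. by move=> ab [<-//|]; exact: klt_trans. Qed.

Lemma kltDl c a b : klt a b -> klt (c `+` a) (c `+` b).
Proof.
move=> [i ab abE]; exists i => [|k ki]; first by rewrite !tailD ltn_add2l.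
by rewrite !tailD abE.
Qed.

Lemma kltD a b c d : klt a b -> kle c d -> klt (a `+` c) (b `+` d).
Proof.
move=> ab cd; apply: (@klt_kle_trans _ (b `+` c)).
  by rewrite ![_ `+` c]msetDC; exact: kltDl.
by case: cd => [->|cd]; [left|right; exact: kltDl].
Qed.

Lemma klt_size a b : klt a b -> (size a <= size b)%N.
Proof.
rewrite -!tail_0 => -[[|i] ab abE]; first exact: ltnW.
by rewrite abE.
Qed.

Lemma size_klt a b : (size a < size b)%N -> klt a b.
Proof. by rewrite -!tail_0 => ab; exists 0%N. Qed.

Lemma klt_mset1 (x y : 'I_n) : klt [mset x] [mset y] -> (x < y)%N.
Proof. by case=> i; rewrite !tail_mset1; lia. Qed.

(** Minimize [tail 0], then [tail 1], and so on; after n steps all tails that can be nonzero are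
    settled. The induction keeps an element that is minimal for the first l tails. *)
Lemma kle_min (S : set {mset 'I_n}) : S !=set0 ->
  exists2 a, S a & forall b, S b -> kle a b.
Proof.
move=> [a0 Sa0].
suff /(_ n)[a Sa amin] : forall l, exists2 a, S a & forall b, S b ->
    (forall j, (j < l)%N -> tail j a = tail j b) \/
    exists2 i, (i < l)%N & (tail i a < tail i b)%N /\
      forall k, (k < i)%N -> tail k a = tail k b.
  exists a => // b /amin [ab|[i _ [ab abE]]]; last by right; exists i.
  left; apply: tail_inj => k; have [/ab//|nk] := ltnP k n.
  by rewrite !tail_ge.
elim=> [|k [a Sa IHk]]; first by exists a0 => // b _; left.
(* Among the elements that share the first k tails of [a], one with the least [tail k] is chosen. *)
have ex : exists t, `[< exists2 a', S a' &
    (forall j, (j < k)%N -> tail j a = tail j a') /\ tail k a' = t >].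
  by exists (tail k a); apply/asboolP; exists a.
case: (ex_minnP ex) => _ /asboolP[a' Sa' [aa' <-]] kmin.
exists a' => // b Sb; have [ab|[i ik [lt abE]]] := IHk b Sb; last first.
  right; exists i; first lia.
  by rewrite -aa'//; split=> // j ji; rewrite -aa' ?abE//; lia.
have : (tail k a' <= tail k b)%N by apply: kmin; apply/asboolP; exists b.
rewrite leq_eqVlt => /orP[/eqP e|lt]; [left|right].
  by move=> j; rewrite ltnS leq_eqVlt => /predU1P[->//|jk]; rewrite -aa' ?ab.
by exists k => //; split=> // j jk; rewrite -aa' ?ab.
Qed.

End MonomialOrder.

Section LeadingTerm.
Variables (n : nat) (R : idomainType).
Implicit Types (f g : mfps 'I_n R) (m a b : {mset 'I_n}) (x y : R).

(* The coefficient [x] may vanish. *)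
Definition lead f m x := (forall m', klt m' m -> f@_m' = 0) /\ f@_m = x.

Lemma lead1 : lead 1 mset0 1.
Proof.
split=> [m' m'0|]; last by rewrite mcoef1 eqxx.
rewrite mcoef1; case: eqP => // m'E; case: (@klt_irr _ m').
by rewrite {2}m'E.
Qed.

(** The order is compatible with multiplication: a nonzero term of the product has both factors at
    or above [a] and [b], and only the pair [a], [b] itself reaches the product monomial. *)
Lemma leadM f g a b x y : lead f a x -> lead g b y -> lead (f * g) (a `+` b) (x * y).
Proof.
move=> [fa <-] [gb <-]; have fg c d : kle (a `+` b) (c `+` d) \/ f@_c * g@_d = 0.
  have [->|ca] := eqVneq c a.
    have [->|/eqP/klt_total[/gb->|bd]] := eqVneq d b; first by left; left.
      by right; rewrite mulr0.
    by left; right; exact: kltDl.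
  have /eqP/klt_total[/fa->|ac] := ca; first by right; rewrite mul0r.
  have [->|/eqP/klt_total[/gb->|bd]] := eqVneq d b.
  - by left; right; apply: kltD => //; left.
  - by right; rewrite mulr0.
  - by left; right; apply: kltD => //; right.
split=> [m lt|].
  apply: mcoefM_eq0 => c cm; have [] := fg c (m `\` c) => //.
  by rewrite msetBDKC// => /(klt_kle_trans lt)/klt_irr.
have cb (c d : {mset 'I_n}) : (c `+` d) `\` c = d.
  by apply/msetP => i; rewrite !msetE2 addKn.
rewrite (mcoefM_single (msubset_addl a b)) ?cb// => c cab ca.
have [/fa->|ac] := klt_total ca; first by rewrite mul0r.
have [e|/eqP/klt_total[/gb->|bd]] := eqVneq ((a `+` b) `\` c) b.
- by case: ca; move: (msetBDK cab); rewrite e msetDC => /(congr1 (msetB^~ b));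
  rewrite !msetDKBC.
- by rewrite mulr0.
- by case: (@klt_irr _ (a `+` b)); rewrite -{2}(msetBDKC cab); apply: kltD => //;
  right.
Qed.

Lemma lead_prod (T : Type) (s : seq T) (P : pred T) (F : T -> mfps 'I_n R)
    (M : T -> {mset 'I_n}) (X : T -> R) :
  (forall t, P t -> lead (F t) (M t) (X t)) ->
  lead (\prod_(t <- s | P t) F t) (\big[msetD/mset0]_(t <- s | P t) M t)
    (\prod_(t <- s | P t) X t).
Proof.
by move=> FM; elim/big_rec3: _ => [|t f m x Pt]; [exact: lead1|apply/leadM/FM].
Qed.

(** The only monomials below x_k are 1 and the x_j with j < k. *)
Lemma lead_deg1 f (k : 'I_n) x : f@_mset0 = 0 ->
  (forall j : 'I_n, (j < k)%N -> f@_[mset j] = 0) -> f@_[mset k] = x ->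
  lead f [mset k] x.
Proof.
move=> f0 fj fk; split=> // m mk; have := klt_size mk.
rewrite size_mset1 leq_eqVlt ltnS leqn0 => /orP[/eqP/mset_size1[j
  mj]|/eqP/size0_mset0->//].
by rewrite mj; apply: fj; apply: klt_mset1; rewrite -mj.
Qed.

(** Otherwise take the least monomial c of g below b: the product of the leading terms of f and g is
    nonzero and sits at a c, below a b. *)
Lemma lead_divl f g a b x : x != 0 -> lead f a x ->
  (forall m, klt m (a `+` b) -> (f * g)@_m = 0) -> forall m, klt m b -> g@_m = 0.
Proof.
move=> x0 fa fg m mb; apply: contrapT => gm.
have [|c [gc cb] cmin] := @kle_min n [set c | g@_c <> 0 /\ klt c b];
  first by exists m.
have gc' : lead g c g@_c.
  split=> // d dc; apply: contrapT => gd.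
  by case: (@klt_irr _ d); apply: (klt_kle_trans dc); apply: cmin; split=> //;
    exact: klt_trans cb.
have [_ /eqP] := leadM fa gc'; rewrite fg; last exact: kltDl.
by rewrite eq_sym mulf_eq0 (negPf x0) => /eqP.
Qed.

End LeadingTerm.

Section FormalSumLead.
Variables (L : idomainType) (a : nat -> nat -> L) (n : nat).
Implicit Types (f g : mfps 'I_n L) (i j k : 'I_n) (x y : L).

Definition minord i j := if (i < j)%N then i else j.

Lemma mvar_coef0 (I : choiceType) (i : I) : (mvar L i)@_mset0 = 0.
Proof.
rewrite /=; case: eqP => // /(congr1 (fun m : {mset I} => size m)).
by rewrite size_mset0 size_mset1.
Qed.

Lemma lead_mvar i : lead (mvar L i) [mset i] 1.
Proof.
apply: lead_deg1 => [|j ji|]; first exact: mvar_coef0.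
  by rewrite /= (inj_eq (msetn_inj _))// -val_eqE ltn_eqF.
by rewrite /= eqxx.
Qed.

Lemma lead_mvarX i p : lead (mvar L i ^+ p) (msetn p i) 1.
Proof.
elim: p => [|p IHp]; first by rewrite expr0 msetn0; exact: lead1.
rewrite exprS -[1]mulr1.
have -> : msetn p.+1 i = [mset i] `+` msetn p i; last exact: leadM (lead_mvar i) IHp.
by apply/msetP => j; rewrite msetE2 !msetnE; case: eqP.
Qed.

Lemma lead_coef0 f i x : lead f [mset i] x -> f@_mset0 = 0.
Proof. by case=> f_lt _; apply/f_lt/size_klt; rewrite size_mset0 size_mset1. Qed.

Lemma lead_coef1 f i j x : lead f [mset i] x -> (j < i)%N -> f@_[mset j] = 0.
Proof.
case=> f_lt _ ji; apply: f_lt.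
by exists j.+1 => [|k kj]; rewrite !tail_mset1; lia.
Qed.

Lemma lead_fgl_add_self f i x : lead f [mset i] x ->
  lead (fgl_add a f f) [mset i] (x + x).
Proof.
move=> fi; have f0 := lead_coef0 fi; apply: lead_deg1 => [|j ji|].
- by rewrite fgl_add_coef0 f0 addr0.
- by rewrite (fgl_add_coef1 a j f0 f0) (lead_coef1 fi ji) addr0.
- by rewrite (fgl_add_coef1 a i f0 f0) fi.2.
Qed.

Lemma lead_fgl_opp f i x : lead f [mset i] x -> lead (fgl_opp a f) [mset i] (- x).
Proof.
move=> fi; have f0 := lead_coef0 fi; apply: lead_deg1 => [|j ji|].
- by have [] := fgl_oppP a f0.
- by rewrite (fgl_opp_coef1 a j f0) (lead_coef1 fi ji) oppr0.
- by rewrite (fgl_opp_coef1 a i f0) fi.2.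
Qed.

(** The linear parts add, and the variable of smaller index comes first; distinct indices rule out
    cancellation. *)
Lemma lead_fgl_add f g i j x y : i != j -> lead f [mset i] x -> lead g [mset j] y ->
  lead (fgl_add a f g) [mset minord i j] (if (i < j)%N then x else y).
Proof.
rewrite -val_eqE /= => ij fi gj.
have f0 := lead_coef0 fi; have g0 := lead_coef0 gj.
apply: lead_deg1 => [|k|]; rewrite /minord.
- by rewrite fgl_add_coef0 f0 g0 addr0.
- move=> k_lt;
  rewrite (fgl_add_coef1 a k f0 g0) (lead_coef1 fi) ?(lead_coef1 gj) ?addr0//;
  by move: k_lt; case: (ltnP i j); lia.
- case: (ltnP i j) => [i_lt|j_le]; rewrite (fgl_add_coef1 a _ f0 g0).
    by rewrite (lead_coef1 gj i_lt) fi.2 addr0.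
  by rewrite (lead_coef1 fi) ?gj.2 ?add0r//; lia.
Qed.

End FormalSumLead.

(** * Strict partitions and their monomials *)

Section StrictPartitions.
Implicit Types (l : strict_partition).

(** Past the end [part] takes the default value 0, which is below every listed part because 0 is not
    listed. *)
Lemma part_lt l i j : (i < j)%N -> (i < plen l)%N -> (part l j < part l i)%N.
Proof.
rewrite /part /plen => ij il; have /andP[ls l0] := valP l.
have [jl|lj] := ltnP j (size (val l)).
  have gtn_trans : transitive gtn by move=> x y z /= yx /ltn_trans; exact.
  exact: (sorted_ltn_nth gtn_trans 0%N ls).
rewrite [X in (X < _)%N]nth_default// lt0n; apply/negP => /eqP e.
by move/negP: l0; apply; have := mem_nth 0%N il; rewrite e.
Qed.

Lemma lt0_part l i : (0 < part l i)%N = (i < plen l)%N.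
Proof.
have [il|li] := ltnP i (plen l); last by rewrite /part nth_default.
by apply: leq_ltn_trans (part_lt (ltnSn i) il).
Qed.

Lemma part_le l i j : (i <= j)%N -> (part l j <= part l i)%N.
Proof.
rewrite leq_eqVlt => /predU1P[->//|ij].
have [il|li] := ltnP i (plen l); first exact/ltnW/part_lt.
by rewrite leqNgt; apply/negP => h; have := lt0_part l j; lia.
Qed.

Lemma part_inj l i j : (i < plen l)%N -> part l i = part l j -> i = j.
Proof.
move=> il e; have [ij|ji|//] := ltngtP i j.
  by have := part_lt ij il; lia.
have jl : (j < plen l)%N by lia.
by have := part_lt ji jl; lia.
Qed.

Lemma strict_partition_ext l l' : part l =1 part l' -> l = l'.
Proof.
move=> e; apply/val_inj.
have ple : plen l = plen l'.
  apply/eqP; rewrite eqn_leq; apply/andP; split; rewrite leqNgt; apply/negP => h.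
    by have := lt0_part l (plen l'); rewrite e lt0_part ltnn h.
  by have := lt0_part l' (plen l); rewrite -e lt0_part ltnn h.
by apply: (@eq_from_nth _ 0%N) => // i _; exact: e.
Qed.

End StrictPartitions.

Section PermutedMonomial.
Variables (l : strict_partition) (n : nat).
Implicit Types (w : 'S_n) (i j k : 'I_n).

(** The monomial carried by the summand of [w] in the symmetrization; [pmono 1] will be the leading
    monomial of P_l and Q_l. *)
Definition pmono w : {mset 'I_n} :=
  \big[msetD/mset0]_(i < n) msetn (part l i) (w i).

Lemma pmonoE w k : pmono w k = part l ((w^-1)%g k).
Proof.
rewrite /pmono (big_morph (fun m : {mset 'I_n} => m k) (id1 := 0%N) (op1 := addn));
  [|by move=> x y; rewrite msetE2|by rewrite mset0E].
rewrite (bigD1 ((w^-1)%g k))//= msetnE permKV eqxx big1 ?addn0// => i ik.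
by rewrite msetnE; case: eqP => // kw; rewrite kw permK eqxx in ik.
Qed.

(** The exponent of x_(w i) is the part of index i on one side and of index w i on the other, and
    positive parts are distinct. *)
Lemma pmono_fixed w i : pmono w = pmono 1 -> (i < plen l)%N -> w i = i.
Proof.
move=> e il; have := congr1 (fun m : {mset 'I_n} => m (w i)) e.
rewrite !pmonoE permK invg1 perm1 => /part_inj e'.
by apply/val_inj/esym/e'.
Qed.

Lemma size_pmono w : size (pmono w) = (\sum_(i < n) part l i)%N.
Proof.
rewrite -tail_0 /tail (reindex_inj (@perm_inj _ w)) /=.
by apply: eq_big => // i _; rewrite pmonoE permK.
Qed.

(** The parts decrease, so the identity puts the largest exponents first. If [pmono w] were smaller,
    let k be the first variable where the exponents differ: there that of [pmono w] is larger, so k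
    = w j with j < k. The agreement at j and the distinctness of positive parts then give w j = j, a
    contradiction. *)
Lemma pmono_min w : kle (pmono 1) (pmono w).
Proof.
have [->|/eqP/klt_total[|//]] := eqVneq (pmono 1) (pmono w); [by left|by right|].
(* All the [pmono w] have the same degree, so the first differing tail has index [i.+1], and the
   exponents first differ at [i]. *)
case=> -[|i]; rewrite ?tail_0 ?size_pmono ?ltnn// => lt eqt; exfalso.
have [ni|ni] := ltnP i n; last by rewrite !tail_ge in lt; lia.
have [k ki] : exists k : 'I_n, i = k by exists (Ordinal ni).
have eqi := eqt i (ltnSn i); rewrite {i}ki in lt eqt eqi ni *.
have agree (j : 'I_n) : (j < k)%N -> pmono w j = pmono 1 j.
  move=> jk; have := eqt j; rewrite !tail_step (eqt j.+1); last lia.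
  by move=> e; apply: (@addIn (tail j.+1 (pmono 1))); apply: e; lia.
have : (pmono 1 k < pmono w k)%N by move: eqi; rewrite !tail_step; lia.
rewrite !pmonoE invg1 perm1; set j := (w^-1)%g k => ltj.
have jk : (j < k)%N.
  by rewrite ltnNge; apply/negP => kj; move: ltj; rewrite ltnNge (part_le l kj).
have jl : (j < plen l)%N by rewrite -lt0_part; exact: leq_ltn_trans ltj.
have := agree j jk; rewrite !pmonoE invg1 perm1 => /esym /(part_inj jl) e.
have wj : w j = j by move/val_inj: e => e; rewrite [in LHS]e permKV.
by move: jk; rewrite -wj /j permKV ltnn.
Qed.

End PermutedMonomial.

(** * The leading terms of P and Q *)

Section ClearDenominators.
Variables (A : idomainType) (n r : nat).
Variables (u v : 'I_n -> 'I_n -> A).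
Implicit Types (w : 'S_n) (p : 'I_n * 'I_n).

Definition offdiag p := p.1 != p.2.
(** The pairs at which the symmetrization has a factor u / v, with [r] the length of the
    partition. *)
Definition numpair p := (p.1 < r)%N && (p.1 < p.2)%N.

(** Permutations permute the off-diagonal pairs, so one common denominator serves the summands of
    all [w]. *)
Lemma reindex_pairs (R : Type) (idx : R) (op : Monoid.com_law idx)
    (h : 'I_n -> 'I_n -> R) w :
  \big[op/idx]_(p | offdiag p) h p.1 p.2 =
  \big[op/idx]_(p | offdiag p) h (w p.1) (w p.2).
Proof.
rewrite (reindex_inj (h := fun p => (w p.1, w p.2))) /=.
  by apply: eq_bigl => p; rewrite /offdiag (inj_eq perm_inj).
by move=> [i j] [i' j'] [/perm_inj -> /perm_inj ->].
Qed.

Hypothesis v_neq0 : forall i j, i != j -> v i j != 0.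

(** With the common denominator written in the variables permuted by [w], each quotient turns its
    own factor v into u and the remaining factors v survive. *)
Lemma clear_quotients w :
  FracField.tofrac (\prod_(p | offdiag p) v p.1 p.2) *
    (\prod_(i < n | (i < r)%N) \prod_(j < n | (i < j)%N)
      (FracField.tofrac (u (w i) (w j)) / FracField.tofrac (v (w i) (w j)))) =
  FracField.tofrac (\prod_(p | offdiag p)
    (if numpair p then u (w p.1) (w p.2) else v (w p.1) (w p.2))).
Proof.
rewrite (reindex_pairs _ v w) !rmorph_prod /=.
rewrite (pair_big_dep (fun i : 'I_n => i < r)%N (fun i j : 'I_n => i < j)%N
  (fun i j => FracField.tofrac (u (w i) (w j)) / FracField.tofrac (v (w i) (w j))))
    /=.
rewrite [X in _ * X](_ : _ = \prod_(p | offdiag p) (if numpair p then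
    FracField.tofrac (u (w p.1) (w p.2)) / FracField.tofrac (v (w p.1) (w p.2))
    else 1)); last first.
  rewrite -big_mkcondr; apply: eq_bigl => p.
  rewrite -[LHS]/(numpair p) /offdiag andb_idl// => /andP[_ p12].
  by rewrite -val_eqE ltn_eqF.
rewrite -big_split; apply: eq_bigr => p pd /=; case: ifP => _; last by rewrite mulr1.
by rewrite mulrC divfK// tofrac_eq0 v_neq0// (inj_eq perm_inj).
Qed.

Lemma clear_symmetrization (g : A) (k : nat) (G : 'S_n -> A) : k%:R != 0 :> A ->
  FracField.tofrac g = k%:R^-1 * (\sum_w FracField.tofrac (G w) *
    \prod_(i < n | (i < r)%N) \prod_(j < n | (i < j)%N)
      (FracField.tofrac (u (w i) (w j)) / FracField.tofrac (v (w i) (w j)))) ->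
  (\prod_(p | offdiag p) v p.1 p.2) * (g *+ k) =
  \sum_w G w * \prod_(p | offdiag p)
    (if numpair p then u (w p.1) (w p.2) else v (w p.1) (w p.2)).
Proof.
move=> k0 gE; apply/eqP; rewrite -tofrac_eq rmorphM rmorphMn /= gE.
rewrite -[X in _ * X]mulr_natl [X in _ * X]mulVKf; last first.
  by rewrite -(rmorph_nat (@FracField.tofrac A)) tofrac_eq0.
rewrite mulr_sumr rmorph_sum; apply/eqP; apply: eq_bigr => w _ /=.
by rewrite rmorphM mulrCA clear_quotients.
Qed.

End ClearDenominators.

Section Symmetrization.
Variables (L : idomainType).
Hypothesis L_char0 : forall k, (0 < k)%N -> k%:R != 0 :> L.
Variables (l : strict_partition) (n : nat).
Variables (u v : 'I_n -> 'I_n -> mfps 'I_n L) (G : 'S_n -> mfps 'I_n L) (c : L).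
Implicit Types (w : 'S_n) (p : 'I_n * 'I_n).

Let sg (i j : 'I_n) : L := if (i < j)%N then 1 else -1.

Hypothesis lead_u : forall i j, i != j -> lead (u i j) [mset minord i j] 1.
Hypothesis lead_v : forall i j, i != j -> lead (v i j) [mset minord i j] (sg i j).
Hypothesis c_neq0 : c != 0.
Hypothesis lead_G : forall w, lead (G w) (pmono l w) c.

Let delta : {mset 'I_n} := \big[msetD/mset0]_(p | offdiag p) [mset minord p.1 p.2].
Let D := \prod_(p | offdiag p) v p.1 p.2.
Let N w := G w * \prod_(p | offdiag p)
  (if numpair (plen l) p then u (w p.1) (w p.2) else v (w p.1) (w p.2)).
Let eps w := \prod_(p | offdiag p) sg (w p.1) (w p.2).

Let deltaE w : delta = \big[msetD/mset0]_(p | offdiag p) [mset minord (w p.1) (w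
  p.2)].
Proof. exact: (reindex_pairs _ (fun i j => [mset minord i j])). Qed.

(** Computing the same leading coefficient after each reindexing shows that [eps w] does not depend
    on [w]. *)
Let lead_D w : lead D delta (eps w).
Proof.
rewrite /D (reindex_pairs _ v w) (deltaE w); apply: lead_prod => p pd.
by apply: lead_v; rewrite (inj_eq perm_inj).
Qed.

Let eps_neq0 w : eps w != 0.
Proof.
by apply/prodf_neq0 => p _; rewrite /sg; case: ifP; rewrite ?oppr_eq0 oner_eq0.
Qed.

Let lead_N w : lead (N w) (delta `+` pmono l w)
  (c * \prod_(p | offdiag p)
    (if numpair (plen l) p then 1 else sg (w p.1) (w p.2))).
Proof.
rewrite msetDC (deltaE w); apply: leadM => //; apply: lead_prod => p pd.
by case: ifP => _; [apply: lead_u|apply: lead_v]; rewrite (inj_eq perm_inj).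
Qed.

Lemma symmetrization_lead g k : (0 < k)%N -> D * (g *+ k) = \sum_w N w ->
  exists2 y, y != 0 & lead g (pmono l 1) y.
Proof.
move=> k_gt0 gE; set M := delta `+` pmono l 1.
have N_lt m w : klt m M -> (N w)@_m = 0.
  move=> mM; apply: (lead_N w).1; apply: klt_kle_trans mM _.
  have [e|lt] := pmono_min l w; first by left; rewrite /M e.
  by right; exact: kltDl.
pose S := [set w : 'S_n | pmono l w == pmono l 1]%SET.
have N_M w : (N w)@_M = if w \in S then c * eps 1 else 0.
  rewrite inE; case: eqP => [e|/eqP ne]; last first.
    apply: (lead_N w).1; apply: kltDl.
    have [e|//] := pmono_min l w; by rewrite e eqxx in ne.
  rewrite /M -e (lead_N w).2; congr (c * _).
  rewrite -(lead_D 1).2 (lead_D w).2; apply: eq_bigr => p pd.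
  (* At a pair with factor u the sign is 1 as well: [w] fixes [p.1], and [w p.2] stays larger, since
     it is either [p.2] itself or an index beyond the length, all smaller indices being fixed. *)
  case: ifP => // /andP[pl p12]; rewrite /sg (pmono_fixed e pl) ifT//.
  have [p2l|lp2] := ltnP p.2 (plen l); first by rewrite (pmono_fixed e p2l).
  rewrite (leq_trans pl)// leqNgt; apply/negP => wl.
  have := pmono_fixed e wl => /perm_inj wp; move: wl; rewrite wp; lia.
have g_lt m : klt m (pmono l 1) -> g@_m = 0.
  move=> mlt; apply/eqP; suff : (g *+ k)@_m == 0.
    by rewrite mcoefMn -mulr_natl mulf_eq0 (negPf (L_char0 k_gt0)).
  apply/eqP; apply: (lead_divl (eps_neq0 1) (lead_D 1)) mlt => m' m'M.
  by rewrite gE mcoef_sum; apply: big1 => w _; exact: N_lt.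
exists g@_(pmono l 1); last by split.
have gk : lead (g *+ k) (pmono l 1) (g@_(pmono l 1) *+ k).
  by split=> [m /g_lt|]; rewrite mcoefMn// => ->; rewrite mul0rn.
have [_] := leadM (lead_D 1) gk; rewrite gE mcoef_sum.
under eq_bigr do rewrite N_M.
(* At [M] the sum is [c * eps 1] times the cardinality of [S]. This is nonzero, as [S] contains the
   identity and positive integers are nonzero in [L], so the coefficient of [g] cannot vanish. *)
rewrite -big_mkcond sumr_const; apply: contra_eq_neq => ->.
rewrite mul0rn mulr0 -mulr_natl !mulf_neq0//.
by apply: L_char0; apply/card_gt0P; exists 1%g; rewrite inE.
Qed.

End Symmetrization.

Section PartitionSize.
Implicit Types (l : strict_partition).

Definition psize l := sumn (val l).

Lemma psizeE l n : (plen l <= n)%N -> psize l = (\sum_(i < n) part l i)%N.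
Proof.
move=> ln; rewrite /psize sumnE (big_nth 0%N) -(big_mkord predT (part l)).
rewrite [RHS](@big_cat_nat _ _ _ (plen l))//= [X in _ = (_ + X)%N]big_nat.
rewrite [X in _ = (_ + X)%N]big1 ?addn0// => i /andP[li _].
by rewrite /part nth_default.
Qed.

Lemma part_psize l i : (part l i <= psize l)%N.
Proof.
rewrite (psizeE (leq_maxl (plen l) i.+1)).
by rewrite (bigD1 (Ordinal (leq_maxr (plen l) i.+1)))//= leq_addr.
Qed.

Lemma plen_psize l : (plen l <= psize l)%N.
Proof.
rewrite (psizeE (leqnn _)) -{1}[plen l]card_ord -sum1_card.
by apply: leq_sum => i _; rewrite lt0_part.
Qed.

Lemma part_eq0 l i : (plen l <= i)%N -> part l i = 0%N.
Proof. by move=> li; rewrite /part nth_default. Qed.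

(** A strict partition of size at most d has at most d parts, each at most d, so a function from
    ['I_d] to ['I_d.+1] encodes it; [dec] is the decoding. *)
Lemma finite_psize d : finite_set [set l | (psize l <= d)%N].
Proof.
have l0 : strict_partition by exists [::].
pose dec (h : {ffun 'I_d -> 'I_d.+1}) : strict_partition :=
  xget l0 [set l | (psize l <= d)%N /\ forall i : 'I_d, part l i = h i].
apply: (@sub_finite_set _ _ (dec @` setT)); last exact/finite_image/finite_finset.
move=> l /= ld; exists [ffun i : 'I_d => inord (part l i)] => //.
have part_d i : @inord d (part l i) = part l i :> nat.
  by rewrite (@inordK d)// ltnS (leq_trans (part_psize _ _)).
rewrite /dec; case: xgetP => [l' _ [l'd l'E]|/(_ l)[]]; last first.
  by split=> // i; rewrite ffunE part_d.
apply: strict_partition_ext => i; have [ltid|di] := ltnP i d.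
  by rewrite (l'E (Ordinal ltid)) ffunE part_d.
by rewrite !part_eq0// (leq_trans (plen_psize _)) ?(leq_trans ld)// (leq_trans l'd).
Qed.

Definition SPle d : {fset strict_partition} := fset_set [set l | (psize l <= d)%N].

Lemma in_SPle d l : (l \in SPle d) = (psize l <= d)%N.
Proof.
by rewrite in_fset_set; [apply/idP/idP; rewrite inE|exact: finite_psize].
Qed.

Lemma size_pmono1 l n : (plen l <= n)%N -> size (pmono l (1 : 'S_n)) = psize l.
Proof. by move=> ln; rewrite size_pmono -psizeE. Qed.

Lemma pmono1_inj l l' n : (plen l <= n)%N -> (plen l' <= n)%N ->
  pmono l (1 : 'S_n) = pmono l' 1 -> l = l'.
Proof.
move=> ln l'n e; apply: strict_partition_ext => i; have [ltin|ni] := ltnP i n.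
  have := congr1 (fun m : {mset 'I_n} => m (Ordinal ltin)) e.
  by rewrite !pmonoE invg1 perm1.
by rewrite !part_eq0// (leq_trans _ ni).
Qed.

End PartitionSize.

(** * Triangularity and formal freeness *)

Section Triangularity.
Variables (L : idomainType).
Implicit Types (f : strict_partition -> mfps nat L) (l : strict_partition)
  (m : {mset nat}).

(** The form in which P and Q enter the duality: in enough variables, the l-th series has leading
    monomial x^l, and these monomials are distinct. *)
Definition triangular f := forall l n, (plen l <= n)%N ->
  exists2 y, y != 0 & lead (xrestr n (f l)) (pmono l (1 : 'S_n)) y.

Section SymmetrizationTriangular.
Variable (a : nat -> nat -> L).
Hypothesis L_char0 : forall k, (0 < k)%N -> k%:R != 0 :> L.

(** Shared by P, with [c = 1], and Q, with [c = 2]. The numerator of each summand has one such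
    factor per part, hence leading coefficient [c] to the power [plen l]. *)
Lemma symmetrization_triangular l n (F : nat -> mfps 'I_n L -> mfps 'I_n L) c g :
  c != 0 ->
  (forall i (k : 'I_n), (i < plen l)%N -> lead (F i (mvar L k)) (msetn (part l i)
    k) c) ->
  (plen l <= n)%N -> FracField.tofrac g = symmetrization a l F ->
  exists2 y, y != 0 & lead g (pmono l (1 : 'S_n)) y.
Proof.
move=> c0 lead_F ln; rewrite /symmetrization ltnNge ln => gE.
pose u i j := fgl_add a (mvar L (i : 'I_n)) (mvar L (j : 'I_n)).
pose v i j := fgl_add a (mvar L (i : 'I_n)) (fgl_opp a (mvar L (j : 'I_n))).
pose G (w : 'S_n) := \prod_(i < n | (i < plen l)%N) F i (mvar L (w i)).
have lead_u i j : i != j -> lead (u i j) [mset minord i j] 1.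
  by move=> ij; have := lead_fgl_add a ij (lead_mvar L i) (lead_mvar L j);
    rewrite if_same.
have lead_v i j : i != j -> lead (v i j) [mset minord i j] (if (i < j)%N then 1
  else -1).
  by move=> ij;
    exact: (lead_fgl_add a ij (lead_mvar L i) (lead_fgl_opp a (lead_mvar L j))).
have v0 i j : i != j -> v i j != 0.
  move=> /lead_v [_]; apply: contra_eq_neq => ->; rewrite mcoef0 eq_sym.
  by case: ifP; rewrite ?oppr_eq0 oner_eq0.
have lead_G w : lead (G w) (pmono l w) (\prod_(i < n | (i < plen l)%N) c).
  rewrite /pmono (bigID (fun i : 'I_n => (i < plen l)%N)) /=.
  rewrite [X in _ `+` X]big1 ?msetD0 => [|i]; last first.
    by rewrite -leqNgt => /part_eq0 ->; rewrite msetn0.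
  by apply: lead_prod => i; exact: lead_F.
have k_gt0 := fact_gt0 (n - plen l).
apply: (symmetrization_lead L_char0 lead_u lead_v _ lead_G k_gt0).
  by apply/prodf_neq0.
apply: (clear_symmetrization (u := u) v0) gE.
have := L_char0 k_gt0;
  apply: contra => /eqP/(congr1 (fun h : mfps 'I_n L => h@_mset0)).
by rewrite mcoef0 mcoefMn mcoef1 eqxx => ->.
Qed.

Lemma isP_triangular P : (forall l, isP a l (P l)) -> triangular P.
Proof.
move=> hP l n ln; apply: (symmetrization_triangular _ _ ln (hP l n)).
  exact: oner_neq0.
by move=> i k _; exact: lead_mvarX.
Qed.

Lemma isQ_triangular Q : (forall l, isQ a l (Q l)) -> triangular Q.
Proof.
move=> hQ l n ln; apply: (symmetrization_triangular _ _ ln (hQ l n)).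
  exact: (L_char0 (ltn0Sn 1)).
move=> i k il; rewrite -[2]mulr1.
(* The part is positive, so its predecessor is a true one: one x comes from x +_F x, together with
   the coefficient 2. *)
have -> : msetn (part l i) k = [mset k] `+` msetn (part l i).-1 k.
  apply/msetP => j; rewrite msetE2 !msetnE; case: eqP => // _.
  by rewrite add1n prednK// lt0_part.
exact: (leadM (lead_fgl_add_self a (lead_mvar L k)) (lead_mvarX _ _ _)).
Qed.

End SymmetrizationTriangular.

Variable (f : strict_partition -> mfps nat L).
Hypothesis f_tri : triangular f.

Lemma triangular_order l m : (size m < psize l)%N -> (f l)@_m = 0.
Proof.
(* The sum of the indices occurring in [m] bounds each of them, so [m] lives in the first n
   variables. *)
pose n := maxn (plen l) (\sum_(i <- m) i).+1;
  have ln : (plen l <= n)%N by exact: leq_maxl.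
have [|m' ->] := @mrename_surj _ _ (val : 'I_n -> nat) m.
  move=> j jm; suff jn : (j < n)%N by exists (Ordinal jn).
  rewrite leq_max; apply/orP; right; rewrite ltnS.
  by rewrite (big_rem j)//= leq_addr.
rewrite size_mrename => lt; have [y _ [y_lt _]] := f_tri ln.
by apply: y_lt; apply: size_klt; rewrite size_pmono1.
Qed.

Lemma triangular_orderM l k m : (size m < psize l + psize k)%N -> (f l * f k)@_m = 0.
Proof.
move=> lt; apply: mcoefM_eq0 => b bm; have [bl|lb] := ltnP (size b) (psize l).
  by rewrite triangular_order ?mul0r.
rewrite [X in _ * X]triangular_order ?mulr0// size_msetB//.
by rewrite ltn_subLR ?size_msubset// (leq_trans lt)// leq_add2r.
Qed.

(** Among the l with nonzero coefficient, take the one with the least leading monomial: no other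
    term of the relation reaches that monomial. Working in d variables is enough, as a partition of
    size at most d has at most d parts. *)
Lemma triangular_free d (b : strict_partition -> L) :
  (forall m, (size m <= d)%N -> \sum_(l <- SPle d) b l * (f l)@_m = 0) ->
  forall l, (psize l <= d)%N -> b l = 0.
Proof.
move=> b_rel l1 l1d; apply: contrapT => bl1.
pose mono l : {mset 'I_d} := pmono l 1.
pose S := [set mono l | l in [set l | (psize l <= d)%N /\ b l <> 0]].
have [|_ [l0 [l0d bl0] <-] l0_min] := @kle_min d S; first by exists (mono l1), l1.
have len l : (psize l <= d)%N -> (plen l <= d)%N by exact/leq_trans/plen_psize.
have [y y0 [_ fy]] := f_tri (len _ l0d).
have := b_rel (mrename val (mono l0)); rewrite size_mrename size_pmono1 ?len//.
move=> /(_ l0d); rewrite (big_fsetD1 l0) ?in_SPle//= big_seq big1 => [|l].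
  by rewrite addr0 -[X in _ * X]/((xrestr d (f l0))@__) fy => /eqP;
    rewrite mulf_eq0 (negPf y0) orbF => /eqP.
rewrite !inE => /andP[ll0]; rewrite in_SPle => ld.
have [->|/eqP bl] := eqVneq (b l) 0; first by rewrite mul0r.
have [_ _ [l_lt _]] := f_tri (len _ ld).
have [|e|lt] := l0_min (mono l); first by exists l.
  by case/eqP: ll0; apply/esym; exact: (pmono1_inj (len _ l0d) (len _ ld) e).
by rewrite [X in _ * X](l_lt _ lt) mulr0.
Qed.

(** Freeness is applied in one factor and then in the other. The relation is known only in total
    degree at most d, so fixing a monomial in one factor lowers the bound for the other; [narrow]
    adapts the range of summation to it. *)
Lemma triangular_free2 d (b : strict_partition -> strict_partition -> L) :
  (forall m m' : {mset nat}, (size m + size m' <= d)%N ->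
    \sum_(l <- SPle d) \sum_(k <- SPle d) b l k * ((f l)@_m * (f k)@_m') = 0) ->
  forall l k, (psize l + psize k <= d)%N -> b l k = 0.
Proof.
have narrow e (F : strict_partition -> L) m : (size m <= e)%N -> (e <= d)%N ->
    \sum_(l <- SPle d) F l * (f l)@_m = \sum_(l <- SPle e) F l * (f l)@_m.
  move=> me ed; apply/esym/big_fset_incl.
    by apply/fsubsetP => l; rewrite !in_SPle => /leq_trans; exact.
  move=> l _; rewrite in_SPle -ltnNge => el.
  by rewrite triangular_order ?mulr0//; exact: leq_ltn_trans el.
move=> b_rel l k lkd.
have {}b_rel (m' : {mset nat}) : (size m' <= d - psize l)%N ->
    \sum_(k <- SPle d) b l k * (f k)@_m' = 0.
  move=> m'd; apply: (@triangular_free (d - size m')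
    (fun l => \sum_(k <- SPle d) b l k * (f k)@_m')); last lia.
  move=> m md; rewrite -(@narrow (d - size m')%N)//; last lia.
  rewrite -[RHS](b_rel m m'); last lia.
  apply: eq_bigr => i _; rewrite mulr_suml; apply: eq_bigr => j _.
  by rewrite -mulrA [X in _ * X]mulrC.
apply: (@triangular_free (d - psize l) (b l)); last lia.
by move=> m' m'd; rewrite -(narrow (d - psize l)%N) ?b_rel//; lia.
Qed.

End Triangularity.

(** * Splitting the Cauchy kernel *)

Section SumMaps.
Variables (I J I' J' : choiceType) (R : comNzRingType).
Implicit Types (p : I -> I') (q : J -> J').

Definition smap p q (s : I + J) : I' + J' :=
  match s with inl i => inl (p i) | inr j => inr (q j) end.

Lemma smap_inj p q : injective p -> injective q -> injective (smap p q).
Proof. by move=> pI qI [i|j] [i'|j'] //= [] => [/pI|/qI] ->. Qed.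

Lemma mrename_smap p q M :
  mrename (smap p q) M = munion (mrename p (minl M)) (mrename q (minr M)).
Proof.
rewrite -[in LHS](munionK M) mrenameD -!(mrename_comp (smap p q)).
by rewrite (mrename_comp inl p) (mrename_comp inr q).
Qed.

Lemma mrestr_mtens p q (f : mfps I' R) (g : mfps J' R) :
  mrestr (smap p q) (mtens f g) = mtens (mrestr p f) (mrestr q g).
Proof.
apply/mfpsP => M; have e := mrename_smap p q M.
have el : minl (mrename (smap p q) M) = mrename p (minl M) by rewrite e minl_union.
have er : minr (mrename (smap p q) M) = mrename q (minr M) by rewrite e minr_union.
exact: congr2 (congr1 (fun m => f@_m) el) (congr1 (fun m => g@_m) er).
Qed.

Lemma mext_mtens p q (f : mfps I R) (g : mfps J R) :
  injective p -> injective q ->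
  mext (smap p q) (mtens f g) = mtens (mext p f) (mext q g).
Proof.
move=> pI qI; have sI := smap_inj pI qI.
rewrite !mtensE (relabelingM (relabeling_mext _ sI)).
rewrite (mext_comp f sI (@inl_inj I J)) (mext_comp g sI (@inr_inj I J)).
by rewrite (mext_comp f (@inl_inj I' J') pI) (mext_comp g (@inr_inj I' J') qI).
Qed.

Lemma mtensM (f f' : mfps I R) (g g' : mfps J R) :
  mtens f g * mtens f' g' = mtens (f * f') (g * g').
Proof.
rewrite !mtensE mulrACA -(relabelingM (relabeling_mext _ (@inl_inj I J))).
by rewrite -(relabelingM (relabeling_mext _ (@inr_inj I J))).
Qed.

End SumMaps.

(** Trades the unspecified finite support for an explicit truncation; both sums agree with the one
    over the union. *)
Lemma finite_sumE (T : choiceType) (V : nmodType) (F : T -> V) s (B : {fset T}) :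
  finite_sum F s -> (forall i, i \notin B -> F i = 0) -> s = \sum_(i <- B) F i.
Proof.
move=> [A FA ->] FB; rewrite (@big_fset_incl _ _ _ _ _ (A `|` B)%fset).
- apply/esym/big_fset_incl; first by rewrite fsubsetUr.
  by move=> i _ /FB.
- by rewrite fsubsetUl.
- by move=> i _ /FA.
Qed.

Section CauchyProduct.
Variables (L : idomainType) (a : nat -> nat -> L).
Variables (f fd : strict_partition -> mfps nat L) (K : mfps (nat + nat)%type L).
Hypothesis f_tri : triangular f.
Hypothesis K_prod : formal_prod (fun ij : nat * nat =>
  fgl_kernel a (mvar L (inl ij.1 : nat + nat)) (mvar L (inr ij.2 : nat + nat))) K.
Hypothesis K_sum : formal_sum (fun l => mtens (f l) (fd l)) K.

Let Kle d := \sum_(l <- SPle d) mtens (f l) (fd l).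

(** Since f_l starts in degree |l|, a bound on the x-degree leaves finitely many l, whatever the
    degree in y. *)
Lemma kernel_truncation d N : (size (minl N) <= d)%N -> K@_N = (Kle d)@_N.
Proof.
move=> Nd; rewrite mcoef_sum; apply: (finite_sumE (K_sum N)) => l.
rewrite in_SPle -ltnNge /= => dl.
by rewrite (triangular_order f_tri) ?mul0r// (leq_ltn_trans Nd).
Qed.

Variables (I J : choiceType) (p1 p2 : nat -> I) (q1 q2 : nat -> J).
Variables (r : I -> nat) (t : J -> nat).
Variable s : nat * nat + nat * nat -> nat * nat.
Hypothesis p1_inj : injective p1.
Hypothesis p2_inj : injective p2.
Hypothesis q1_inj : injective q1.
Hypothesis q2_inj : injective q2.
Hypothesis r_inj : injective r.
Hypothesis t_inj : injective t.
Hypothesis s_bij : bijective s.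
Hypothesis s1 : forall ij, s (inl ij) = (r (p1 ij.1), t (q1 ij.2)).
Hypothesis s2 : forall ij, s (inr ij) = (r (p2 ij.1), t (q2 ij.2)).

Let rt_rel := relabeling_mrestr L (smap_inj r_inj t_inj).
Let pq1_rel := relabeling_mext L (smap_inj p1_inj q1_inj).
Let pq2_rel := relabeling_mext L (smap_inj p2_inj q2_inj).

Let kernel_mrestr i j :
  mrestr (smap r t) (fgl_kernel a (mvar L (inl (r i) : nat + nat))
    (mvar L (inr (t j) : nat + nat))) =
  fgl_kernel a (mvar L (inl i : I + J)) (mvar L (inr j : I + J)).
Proof.
have rtI := smap_inj r_inj t_inj.
have ei : mrestr (smap r t) (mvar L (inl (r i) : nat + nat)) = mvar L (inl i : I + J).
  exact: (mrestr_mvar L rtI (inl i)).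
have ej : mrestr (smap r t) (mvar L (inr (t j) : nat + nat)) = mvar L (inr j : I + J).
  exact: (mrestr_mvar L rtI (inr j)).
exact: (relabeling_fgl_kernel rt_rel a (mvar_coef0 _ _) (mvar_coef0 _ _) ei ej).
Qed.

Let kernel_mext (p : nat -> I) (q : nat -> J) i j : injective p -> injective q ->
  mext (smap p q) (fgl_kernel a (mvar L (inl i : nat + nat))
    (mvar L (inr j : nat + nat))) =
  fgl_kernel a (mvar L (inl (p i) : I + J)) (mvar L (inr (q j) : I + J)).
Proof.
move=> pI qI; have sI := smap_inj pI qI.
have ei : mext (smap p q) (mvar L (inl i : nat + nat)) = mvar L (inl (p i) : I + J).
  exact: (mext_mvar L sI (inl i)).
have ej : mext (smap p q) (mvar L (inr j : nat + nat)) = mvar L (inr (q j) : I + J).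
  exact: (mext_mvar L sI (inr j)).
exact: (relabeling_fgl_kernel (relabeling_mext _ sI) a (mvar_coef0 _ _) (mvar_coef0
  _ _) ei ej).
Qed.

(** One statement for doubling either set of variables: [r] and [t] restrict K to the variables in
    [I] and [J], the pairs [p1], [q1] and [p2], [q2] place two copies of K there, and [s]
    distributes the factors k(x_i, y_j) among the copies. *)
Lemma kernel_split :
  mrestr (smap r t) K = mext (smap p1 q1) K * mext (smap p2 q2) K.
Proof.
apply: (formal_prod_split rt_rel pq1_rel pq2_rel s_bij _ _ K_prod) => ij.
  by rewrite s1 kernel_mrestr kernel_mext.
by rewrite s2 kernel_mrestr kernel_mext.
Qed.

Let mext_truncation (p : nat -> I) (q : nat -> J) d N :
  injective p -> injective q -> (size (minl N) <= d)%N ->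
  (mext (smap p q) K)@_N = (mext (smap p q) (Kle d))@_N.
Proof.
move=> pI qI; have sI := smap_inj pI qI.
have [[m ->]|/forallNP nN] := pselect (exists m, N = mrename (smap p q) m).
  rewrite mrename_smap minl_union size_mrename -mrename_smap => md.
  by rewrite !(mextE sI) (kernel_truncation md).
by rewrite !(mext_notin _ nN).
Qed.

(** All divisors of [M] have x-degree at most d as well, so each K in the split kernel may be
    replaced by its truncation, and the product of finite sums expanded. *)
Lemma cauchy_split d M : (size (minl M) <= d)%N ->
  \sum_(n <- SPle d) (mrestr r (f n))@_(minl M) * (mrestr t (fd n))@_(minr M) =
  \sum_(l <- SPle d) \sum_(k <- SPle d)
    (mext p1 (f l) * mext p2 (f k))@_(minl M) *
    (mext q1 (fd l) * mext q2 (fd k))@_(minr M).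
Proof.
move=> Md.
have -> : \sum_(n <- SPle d) (mrestr r (f n))@_(minl M) * (mrestr t (fd n))@_(minr M)
    = (mrestr (smap r t) K)@_M.
  rewrite [RHS](@kernel_truncation d); last first.
    by rewrite mrename_smap minl_union size_mrename.
  rewrite mcoef_sum; apply: eq_bigr => l _.
  have := congr1 (fun h : mfps (I + J)%type L => h@_M) (mrestr_mtens r t (f l) (fd
    l)).
  by move=> /= ->.
rewrite kernel_split.
rewrite (@eq_mcoefM _ _ _ (mext (smap p1 q1) (Kle d)) _ (mext (smap p2 q2) (Kle d))).
  rewrite (relabeling_sum pq1_rel) (relabeling_sum pq2_rel) big_distrlr mcoef_sum /=.
  apply: eq_bigr => l _; rewrite mcoef_sum; apply: eq_bigr => k _.
  by rewrite (mext_mtens _ _ p1_inj q1_inj) (mext_mtens _ _ p2_inj q2_inj) mtensM.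
move=> b bM; rewrite (@mext_truncation _ _ d)//; last first.
  exact: leq_trans (size_msubset (minl_sub bM)) Md.
rewrite (@mext_truncation _ _ d)//.
exact: leq_trans (size_msubset (minl_sub (msubsetBl _ _))) Md.
Qed.

End CauchyProduct.

(** * Duality *)

Section Duality.
Variables (L : idomainType) (a : nat -> nat -> L).
Variables (f fd : strict_partition -> mfps nat L).
Hypothesis f_tri : triangular f.
Hypothesis f_cauchy : cauchy_expansion a f fd.

Let id_mrestr (g : mfps nat L) : mrestr id g = g.
Proof. by apply/mfpsP => m; rewrite /= /mrename map_id seq_mset_id. Qed.

Let id_mext (g : mfps nat L) : mext id g = g.
Proof.
have mren (m : {mset nat}) : mrename id m = m by rewrite /mrename map_id seq_mset_id.
by apply/mfpsP => m; have := mextE (@inj_id nat) g m; rewrite mren.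
Qed.

Let interleave_inj : injective interleave.
Proof.
move=> [i|i] [j|j] /= e; first by congr inl; lia.
- by have := congr1 odd e; rewrite /= !odd_double.
- by have := congr1 odd e; rewrite /= !odd_double.
- by congr inr; lia.
Qed.

Let deinterleave (k : nat) : nat + nat := if odd k then inr k./2 else inl k./2.

Let interleaveK : cancel interleave deinterleave.
Proof. by move=> [i|i];
  rewrite /deinterleave /= ?uphalf_double ?odd_double ?doubleK. Qed.

Let deinterleaveK : cancel deinterleave interleave.
Proof.
by move=> k; rewrite /deinterleave; case: ifP => /= ok; have := odd_double_half k;
  rewrite ok.
Qed.

(** The case K(x; y, y') = K(x; y) K(x; y'): only the y-variables are doubled, and [s] sends the
    factor at (i, j) to a copy according to the parity of j. *)
Let coproduct_fd d (m : {mset nat}) (u : {mset (nat + nat)%type}) : (size m <= d)%N ->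
  \sum_(n <- SPle d) (f n)@_m * (mcoprod (fd n))@_u =
  \sum_(l <- SPle d) \sum_(k <- SPle d) (f l * f k)@_m * (mtens (fd l) (fd k))@_u.
Proof.
have [K K_prod K_sum] := f_cauchy => md.
pose s (z : nat * nat + nat * nat) := match z with
  | inl ij => (ij.1, interleave (inl ij.2)) | inr ij => (ij.1, interleave (inr
    ij.2)) end.
have s_bij : bijective s.
  exists (fun ij => match deinterleave ij.2 with
    | inl j => inl (ij.1, j) | inr j => inr (ij.1, j) end).
    by move=> [[i j]|[i j]]; rewrite /s interleaveK.
  move=> [i j]; rewrite /s /=; move: (deinterleaveK j).
  by case: (deinterleave j) => k <-.
have := @cauchy_split _ _ _ _ _ f_tri K_prod K_sum _ _ id id inl inr id interleave s
  (@inj_id _) (@inj_id _) (@inl_inj _ _) (@inr_inj _ _) (@inj_id _) interleave_inj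
  s_bij (fun ij => erefl) (fun ij => erefl) d (munion m u).
rewrite minl_union minr_union => /(_ md).
under eq_bigr do rewrite id_mrestr.
move=> ->; apply: eq_bigr => l _; apply: eq_bigr => k _.
by rewrite !id_mext mtensE.
Qed.

(** The case K(x, x'; y) = K(x; y) K(x'; y), with the roles of the two indices exchanged. *)
Let coproduct_f d (u : {mset (nat + nat)%type}) (m : {mset nat}) : (size u <= d)%N ->
  \sum_(n <- SPle d) (mcoprod (f n))@_u * (fd n)@_m =
  \sum_(l <- SPle d) \sum_(k <- SPle d) (mtens (f l) (f k))@_u * (fd l * fd k)@_m.
Proof.
have [K K_prod K_sum] := f_cauchy => ud.
pose s (z : nat * nat + nat * nat) := match z with
  | inl ij => (interleave (inl ij.1), ij.2) | inr ij => (interleave (inr ij.1),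
    ij.2) end.
have s_bij : bijective s.
  exists (fun ij => match deinterleave ij.1 with
    | inl i => inl (i, ij.2) | inr i => inr (i, ij.2) end).
    by move=> [[i j]|[i j]]; rewrite /s interleaveK.
  move=> [i j]; rewrite /s /=; move: (deinterleaveK i).
  by case: (deinterleave i) => k <-.
have := @cauchy_split _ _ _ _ _ f_tri K_prod K_sum _ _ inl inr id id interleave id s
  (@inl_inj _ _) (@inr_inj _ _) (@inj_id _) (@inj_id _) interleave_inj (@inj_id _)
  s_bij (fun ij => erefl) (fun ij => erefl) d (munion u m).
rewrite minl_union minr_union => /(_ ud).
under eq_bigr do rewrite id_mrestr.
move=> ->; apply: eq_bigr => l _; apply: eq_bigr => k _.
by rewrite !id_mext mtensE.
Qed.

Let SPle2 d : {fset strict_partition * strict_partition} :=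
  [fset z in [seq (l, k) | l <- SPle d, k <- SPle d]]%fset.

Let in_SPle2 d z : (z \in SPle2 d) = (psize z.1 <= d)%N && (psize z.2 <= d)%N.
Proof.
rewrite inE -!in_SPle; case: z => l k /=; apply/allpairsP/andP => [[[l' k']]|[ld kd]].
  by move=> /= [ld kd [-> ->]].
by exists (l, k).
Qed.

Let big_SPle2 d (F : strict_partition * strict_partition -> L) :
  \sum_(z <- SPle2 d) F z = \sum_(l <- SPle d) \sum_(k <- SPle d) F (l, k).
Proof.
rewrite (perm_big [seq (l, k) | l <- SPle d, k <- SPle d]);
  first by rewrite big_allpairs.
apply: uniq_perm; rewrite ?fset_uniq// ?allpairs_uniq ?fset_uniq//;
  first by move=> [? ?] [? ?].
by move=> z; rewrite inE.
Qed.

Theorem product_dual_coproduct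
    (c : strict_partition -> strict_partition -> strict_partition -> L) :
  (forall l k, formal_sum (fun n => c l k n *: f n) (f l * f k)) ->
  forall n, finite_sum (fun lk : strict_partition * strict_partition =>
    c lk.1 lk.2 n *: mtens (fd lk.1) (fd lk.2)) (mcoprod (fd n)).
Proof.
move=> c_sum n; set d := psize n.
have cE e l k (m : {mset nat}) : (size m <= e)%N ->
    (f l * f k)@_m = \sum_(i <- SPle e) c l k i * (f i)@_m.
  move=> me; apply: finite_sumE (c_sum l k m) _ => i; rewrite in_SPle -ltnNge => ei.
  by rewrite mcoefZ (triangular_order f_tri) ?mulr0// (leq_ltn_trans me).
(* The product of f_l and f_k starts in degree |l| + |k|, so freeness up to degree d kills its
   coefficient at n. This is what makes the dual sum finite. *)
have c0 l k : (d < psize l + psize k)%N -> c l k n = 0.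
  move=> dlk; apply: (triangular_free f_tri (d := d) (b := c l k)) => // m md.
  by rewrite -cE// (triangular_orderM f_tri)// (leq_ltn_trans md).
have coprodE u : (mcoprod (fd n))@_u =
    \sum_(l <- SPle d) \sum_(k <- SPle d) c l k n * (mtens (fd l) (fd k))@_u.
  apply/eqP; rewrite -subr_eq0; apply/eqP.
  (* At a fixed y-monomial [u], the differences of the two sides for all partitions of size at most
     d form a linear relation between the f_i, which the split kernel shows to hold up to degree
     d. *)
  apply: (triangular_free f_tri (d := d) (b := fun i => (mcoprod (fd i))@_u -
    \sum_(l <- SPle d) \sum_(k <- SPle d) c l k i * (mtens (fd l) (fd k))@_u)) =>
      // m md.
  under eq_bigr do rewrite mulrBl.
  rewrite sumrB; apply/eqP; rewrite subr_eq0; apply/eqP.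
  under eq_bigr do rewrite mulrC.
  rewrite coproduct_fd//; under [RHS]eq_bigr do rewrite mulr_suml.
  rewrite [RHS]exchange_big; apply: eq_bigr => l _.
  under [RHS]eq_bigr do rewrite mulr_suml.
  rewrite [RHS]exchange_big; apply: eq_bigr => k _.
  by rewrite (cE d)// mulr_suml; apply: eq_bigr => i _; rewrite mulrAC.
exists (SPle2 d) => [[l k]|].
  rewrite in_SPle2 /= => /negP lkd; rewrite c0 ?scale0r// ltnNge; apply/negP => lk.
  by apply: lkd; lia.
by apply/mfpsP => u; rewrite coprodE mcoef_sum big_SPle2.
Qed.

Theorem coproduct_dual_product
    (c : strict_partition -> strict_partition -> strict_partition -> L) :
  (forall n, formal_sum (fun lk : strict_partition * strict_partition =>
    c lk.1 lk.2 n *: mtens (f lk.1) (f lk.2)) (mcoprod (f n))) ->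
  forall l k, finite_sum (fun n => c l k n *: fd n) (fd l * fd k).
Proof.
move=> c_sum l0 k0; set d := (psize l0 + psize k0)%N.
have cE e n (u : {mset (nat + nat)%type}) : (size u <= e)%N -> (mcoprod (f n))@_u =
    \sum_(l <- SPle e) \sum_(k <- SPle e) c l k n * (mtens (f l) (f k))@_u.
  move=> ue;
    rewrite -(big_SPle2 e (fun z => c z.1 z.2 n * (mtens (f z.1) (f z.2))@_u)).
  apply: finite_sumE (c_sum n u) _ => -[l k]; rewrite in_SPle2 negb_and -!ltnNge.
  rewrite mcoefZ /=; have := size_munion (minl u) (minr u); rewrite munionK => uE.
  have ul : (size (minl u) <= e)%N by rewrite (leq_trans _ ue)// uE leq_addr.
  have ur : (size (minr u) <= e)%N by rewrite (leq_trans _ ue)// uE leq_addl.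
  move=> /orP[el|ek].
    by rewrite (triangular_order f_tri (leq_ltn_trans ul el)) mul0r mulr0.
  by rewrite (triangular_order f_tri (leq_ltn_trans ur ek)) !mulr0.
(* The coproduct of f_n starts in degree |n|, above the total degree d of the pair, so freeness in
   two sets of variables applies. *)
have c0 n : (d < psize n)%N -> c l0 k0 n = 0.
  move=> dn;
    apply: (triangular_free2 f_tri (d := d) (b := fun l k => c l k n)) => // m m' mm'.
  have ud : (size (munion m m') <= d)%N by rewrite size_munion.
  have := cE d n _ ud; rewrite [LHS](triangular_order f_tri); last first.
    by rewrite size_mrename (leq_ltn_trans ud).
  move=> /esym cn; rewrite -[RHS]cn; apply: eq_bigr => l _; apply: eq_bigr => k _.
  by rewrite /= minl_union minr_union.
exists (SPle d) => [n|].
  by rewrite in_SPle -ltnNge => /c0 ->; rewrite scale0r.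
apply/mfpsP => m; rewrite mcoef_sum; apply/esym/eqP; rewrite -subr_eq0; apply/eqP.
(* At a fixed y-monomial [m], the differences for all pairs l, k are the coefficients of a relation
   between the f_l(x) f_k(x'), valid up to degree d = |l0| + |k0|. *)
apply: (triangular_free2 f_tri (d := d) (b := fun l k =>
  \sum_(n <- SPle d) (c l k n *: fd n)@_m - (fd l * fd k)@_m)) => // m1 m2 md.
have ud : (size (munion m1 m2) <= d)%N by rewrite size_munion.
have mtensE' l k : (f l)@_m1 * (f k)@_m2 = (mtens (f l) (f k))@_(munion m1 m2).
  by rewrite /= minl_union minr_union.
under eq_bigr do under eq_bigr do rewrite mulrBl mtensE' [X in _ - X]mulrC.
under eq_bigr do rewrite sumrB.
rewrite sumrB -coproduct_f//; apply/eqP; rewrite subr_eq0; apply/eqP.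
under [RHS]eq_bigr do rewrite (cE d)// mulr_suml.
rewrite [RHS]exchange_big; apply: eq_bigr => l _.
under [RHS]eq_bigr do rewrite mulr_suml.
rewrite [RHS]exchange_big; apply: eq_bigr => k _.
by rewrite mulr_suml; apply: eq_bigr => n _; rewrite mcoefZ mulrAC.
Qed.

End Duality.

(** * Characteristic zero and conclusion *)

Lemma universal_fgl_char0 (L : comNzRingType) (a : nat -> nat -> L) :
  universal_fgl a -> forall k, (0 < k)%N -> k%:R != 0 :> L.
Proof.
move=> [_ a_univ] k k_gt0.
(* All coefficients a_{i,j} equal to 0 give the additive law u + v over the integers. *)
have [|h _ _] := a_univ int (fun _ _ => 0).
  have addE f g : fgl_add (fun _ _ => 0 : int) f g = f + g :> mfps nat int.
    apply/mfpsP => m; rewrite fgl_addE big1 ?addr0// => i _.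
    by rewrite big1// => j _; rewrite mul0r.
  have addA (u v w : mfps nat int) : fgl_add (fun _ _ => 0) (fgl_add (fun _ _ => 0)
    u v) w =
      fgl_add (fun _ _ => 0) u (fgl_add (fun _ _ => 0) v w) by rewrite !addE addrA.
  by split=> [//|u v w]; exact: addA.
apply/negP => /eqP/(congr1 h)/eqP; rewrite rmorph_nat rmorph0 Num.Theory.pnatr_eq0.
by rewrite -leqn0 leqNgt k_gt0.
Qed.

Theorem proposition5p7 (L : idomainType) (a : nat -> nat -> L)
    (hL : universal_fgl a)
    (P Q : strict_partition -> mfps nat L)
    (hP : forall l, isP a l (P l)) (hQ : forall l, isQ a l (Q l))
    (pk qk : nat -> mfps nat L) (hk : one_row_duals a pk qk)
    (ph qh : strict_partition -> mfps nat L)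
    (hphG : forall l, in_subalg pk (ph l)) (hqhG : forall l, in_subalg qk (qh l))
    (hph : cauchy_expansion a Q ph) (hqh : cauchy_expansion a P qh) :
  ((forall c : strict_partition -> strict_partition -> strict_partition -> L,
      (forall l m, formal_sum (fun n => c l m n *: Q n) (Q l * Q m)) ->
      forall n, finite_sum
        (fun lm : strict_partition * strict_partition =>
           c lm.1 lm.2 n *: mtens (ph lm.1) (ph lm.2))
        (mcoprod (ph n))) /\
   (forall c : strict_partition -> strict_partition -> strict_partition -> L,
      (forall n, formal_sum
        (fun lm : strict_partition * strict_partition =>
           c lm.1 lm.2 n *: mtens (Q lm.1) (Q lm.2))
        (mcoprod (Q n))) ->
      forall l m, finite_sum (fun n => c l m n *: ph n) (ph l * ph m))) /\
  ((forall d : strict_partition -> strict_partition -> strict_partition -> L,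
      (forall l m, formal_sum (fun n => d l m n *: P n) (P l * P m)) ->
      forall n, finite_sum
        (fun lm : strict_partition * strict_partition =>
           d lm.1 lm.2 n *: mtens (qh lm.1) (qh lm.2))
        (mcoprod (qh n))) /\
   (forall d : strict_partition -> strict_partition -> strict_partition -> L,
      (forall n, formal_sum
        (fun lm : strict_partition * strict_partition =>
           d lm.1 lm.2 n *: mtens (P lm.1) (P lm.2))
        (mcoprod (P n))) ->
      forall l m, finite_sum (fun n => d l m n *: qh n) (qh l * qh m))).

Proof.
have L_char0 := universal_fgl_char0 hL.
have P_tri := isP_triangular L_char0 hP; have Q_tri := isQ_triangular L_char0 hQ.
split; split.
- exact: product_dual_coproduct Q_tri hph.
- exact: coproduct_dual_product Q_tri hph.
- exact: product_dual_coproduct P_tri hqh.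
- exact: coproduct_dual_product P_tri hqh.
Qed.
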